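(* Let $X$ be a separable Hilbert space, $m\ge1$, and $f(z)=\sum_{k\ge0}\hat f(\alpha_k)z^{\alpha_k}\in H^2(\mathbb{D}^m,X)$, where $\sigma(f)=\{\alpha_k:k\ge0\}\subset\mathbb{Z}_+^m$ (distinct multi-indices $\alpha_k=(\alpha_{k,1},\dots,\alpha_{k,m})$) satisfies: (C1) there is a constant $C$ such that for every $\beta\in\mathbb{Z}^m$, $\#\{(\alpha,\alpha')\in\sigma(f)^2:\alpha\neq\alpha',\ \alpha-\alpha'=\beta\}\le C$; (C2) $\lim_{k\to\infty}(\alpha_{k+1,j}-\alpha_{k,j})=\infty$ for every $j=1,\dots,m$; and suppose $(\hat f(\alpha_k))_{k\ge0}$ is completely relatively compact in $X$. Then $f$ is cyclic for the backward shift semigroup in $H^2(\mathbb{D}^m,X)$ if and only if $\operatorname{span}\{\hat f(\alpha_j):j\ge k\}=X$ for every $k\ge0$.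
   Context: $H^2(\mathbb{D}^m,X)=\{f(z)=\sum_{\alpha\in\mathbb{Z}_+^m}\hat f(\alpha)z^\alpha:\hat f(\alpha)\in X,\ \sum\|\hat f(\alpha)\|^2<\infty\}$, $z^\alpha=z_1^{\alpha_1}\cdots z_m^{\alpha_m}$. For $\alpha\in\mathbb{Z}_+^m$, $S^{*\alpha}f(z)=\sum_{\beta\ge0}\hat f(\alpha+\beta)z^\beta$. $E_f$ is the closed span of $\{S^{*\alpha}f:\alpha\in\mathbb{Z}_+^m\}$ and $f$ is cyclic if $E_f=H^2(\mathbb{D}^m,X)$. $\sigma(f)=\{\alpha:\hat f(\alpha)\ne0\}$. Completely relatively compact: for every orthogonal projection $P$ on $X$, $(Pa_k/\|Pa_k\|)_{Pa_k\ne0}$ is relatively compact. span = closed linear span. *)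

(* Defs.v *)
From Stdlib Require Vectors.Fin.
From Stdlib Require Import Reals ZArith List.
Open Scope R_scope.

Record Cx : Type := mkCx { Cre : R; Cim : R }.
Definition C0 : Cx := mkCx 0 0.
Definition C1 : Cx := mkCx 1 0.
Definition Cadd (a b : Cx) : Cx := mkCx (Cre a + Cre b) (Cim a + Cim b).
Definition Cmul (a b : Cx) : Cx :=
  mkCx (Cre a * Cre b - Cim a * Cim b) (Cre a * Cim b + Cim a * Cre b).
Definition Cconj (a : Cx) : Cx := mkCx (Cre a) (- Cim a).
Definition RtoC (r : R) : Cx := mkCx r 0.

Record Hilbert : Type := {
  hcarrier :> Type;
  hzero : hcarrier;
  hadd : hcarrier -> hcarrier -> hcarrier;
  hopp : hcarrier -> hcarrier;
  hscal : Cx -> hcarrier -> hcarrier;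
  hinner : hcarrier -> hcarrier -> Cx;
  hadd_assoc : forall x y z, hadd x (hadd y z) = hadd (hadd x y) z;
  hadd_comm : forall x y, hadd x y = hadd y x;
  hadd_0 : forall x, hadd x hzero = x;
  hadd_opp : forall x, hadd x (hopp x) = hzero;
  hscal_1 : forall x, hscal C1 x = x;
  hscal_assoc : forall a b x, hscal a (hscal b x) = hscal (Cmul a b) x;
  hscal_distr_l : forall a x y, hscal a (hadd x y) = hadd (hscal a x) (hscal a y);
  hscal_distr_r : forall a b x, hscal (Cadd a b) x = hadd (hscal a x) (hscal b x);
  hinner_add_l : forall x y z, hinner (hadd x y) z = Cadd (hinner x z) (hinner y z);
  hinner_scal_l : forall a x y, hinner (hscal a x) y = Cmul a (hinner x y);
  hinner_conj : forall x y, hinner y x = Cconj (hinner x y);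
  hinner_pos : forall x, 0 <= Cre (hinner x x);
  hinner_def : forall x, hinner x x = C0 -> x = hzero;
  hcomplete : forall u : nat -> hcarrier,
    (forall eps, 0 < eps -> exists N, forall n p, (N <= n)%nat -> (N <= p)%nat ->
        sqrt (Cre (hinner (hadd (u n) (hopp (u p))) (hadd (u n) (hopp (u p))))) < eps) ->
    exists y, forall eps, 0 < eps -> exists N, forall n, (N <= n)%nat ->
        sqrt (Cre (hinner (hadd (u n) (hopp y)) (hadd (u n) (hopp y)))) < eps
}.

Section HilbertDefs.
Variable X : Hilbert.

Definition hnorm (x : X) : R := sqrt (Cre (hinner X x x)).
Definition hsub (x y : X) : X := hadd X x (hopp X y).

Definition converges (u : nat -> X) (y : X) : Prop :=
  forall eps, 0 < eps -> exists N, forall n, (N <= n)%nat -> hnorm (hsub (u n) y) < eps.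

Definition separable : Prop :=
  exists d : nat -> X, forall x eps, 0 < eps -> exists n, hnorm (hsub x (d n)) < eps.

Definition lincomb {I : Type} (v : I -> X) (l : list (Cx * I)) : X :=
  fold_right (fun p acc => hadd X (hscal X (fst p) (v (snd p))) acc) (hzero X) l.

Definition closed_span_is_X {I : Type} (P : I -> Prop) (v : I -> X) : Prop :=
  forall x eps, 0 < eps -> exists l : list (Cx * I),
    (forall p, In p l -> P (snd p)) /\ hnorm (hsub x (lincomb v l)) <= eps.

Definition orth_projection (P : X -> X) : Prop :=
  (forall x y, P (hadd X x y) = hadd X (P x) (P y)) /\
  (forall a x, P (hscal X a x) = hscal X a (P x)) /\
  (forall x, P (P x) = P x) /\
  (forall x y, hinner X (P x) y = hinner X x (P y)).

Definition rel_compact (A : X -> Prop) : Prop :=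
  forall u : nat -> X, (forall n, A (u n)) ->
    exists (phi : nat -> nat) (y : X),
      (forall n, (phi n < phi (S n))%nat) /\ converges (fun n => u (phi n)) y.

Definition completely_rel_compact (a : nat -> X) : Prop :=
  forall P : X -> X, orth_projection P ->
    rel_compact (fun y => exists k, P (a k) <> hzero X /\
                     y = hscal X (RtoC (/ hnorm (P (a k)))) (P (a k))).
End HilbertDefs.

Definition multi (m : nat) := Fin.t m -> nat.
Definition multi_add {m} (a b : multi m) : multi m := fun j => (a j + b j)%nat.

Section H2.
Variables (X : Hilbert) (m : nat).

(* f is given by its coefficient function fhat : Z_+^m -> X *)
Definition in_H2 (f : multi m -> X) : Prop :=
  exists M, forall l : list (multi m), NoDup l ->
    fold_right (fun a s => hnorm X (f a) ^ 2 + s) 0 l <= M.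

Definition H2_dist_le (f g : multi m -> X) (eps : R) : Prop :=
  forall l : list (multi m), NoDup l ->
    fold_right (fun a s => hnorm X (hsub X (f a) (g a)) ^ 2 + s) 0 l <= eps ^ 2.

Definition bshift (alpha : multi m) (f : multi m -> X) : multi m -> X :=
  fun beta => f (multi_add alpha beta).

Definition H2_lincomb (l : list (Cx * multi m)) (f : multi m -> X) : multi m -> X :=
  fun beta => lincomb X (fun alpha => bshift alpha f beta) l.

Definition cyclic (f : multi m -> X) : Prop :=
  forall g, in_H2 g -> forall eps, 0 < eps ->
    exists l : list (Cx * multi m), H2_dist_le g (H2_lincomb l f) eps.

Definition in_spectrum (f : multi m -> X) (alpha : multi m) : Prop :=
  f alpha <> hzero X.
End H2.

(* Main.v *)
Require Import Defs.
From Stdlib Require Vectors.Fin.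
From Stdlib Require Import Reals ZArith List.
From Stdlib Require Import Lra Lia Classical ClassicalEpsilon FunctionalExtensionality.
From Stdlib Require Cantor.
Open Scope R_scope.

(** If [f] is cyclic, approximating [x z^gamma] with [gamma] beyond the first k multi-indices
    and reading off the coefficient at [gamma] puts [x] in the closed span of the later
    coefficients.

    Conversely, let [h] be the component of a given [g] orthogonal to all backward shifts of
    [f]. Put a_k = f(alpha_k), let P be the orthogonal projection of X onto the closed span of
    the [h gamma], and b_k = P a_k. Orthogonality of [h] to the shift of [f] by
    [alpha_k - gamma] expresses <b_k, h gamma>, for large k, through the terms
    <b_j, h(alpha_j - alpha_k + gamma)> with j > k only, so that
    |<b_k, h gamma>|^2 <= (sum_{j>k} |b_j|^2) e_gamma(k), where sum_k e_gamma(k) <= C |h|^2 by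
    the bounded multiplicity of differences. Compactness of the normalized b_k gives finitely
    many [gamma] and c > 0 with c |b_k|^2 <= sum_gamma |<b_k, h gamma>|^2. Summing over k >= K
    with K large, the tail sum of |b_k|^2 is at most half of itself, hence b_k = 0 for k >= K:
    the late a_k are orthogonal to every [h gamma]. As they span X, h = 0. *)

(** * Finite sums and summable families *)

Definition lsum {I : Type} (g : I -> R) (l : list I) : R :=
  fold_right (fun a s => g a + s) 0 l.

(** Classical decidability gives duplicate removal and counting on any index type, function types
    such as [multi m] included. *)
Definition eq_decide (I : Type) (x y : I) : {x = y} + {x <> y} :=
  excluded_middle_informative (x = y).

Definition pdec (P : Prop) : bool :=
  if excluded_middle_informative P then true else false.

Lemma pdec_true (P : Prop) : pdec P = true <-> P.
Proof. unfold pdec; destruct (excluded_middle_informative P); split; intuition discriminate. Qed.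

Section Sums.
Variable I : Type.
Implicit Types (g : I -> R) (l : list I).

Lemma lsum_ext g g' l : (forall x, In x l -> g x = g' x) -> lsum g l = lsum g' l.
Proof.
  induction l as [|a l IH]; simpl; intros H; [reflexivity|].
  rewrite H by auto. rewrite IH by auto. reflexivity.
Qed.

Lemma lsum_cons g a l : lsum g (a :: l) = g a + lsum g l.
Proof. reflexivity. Qed.

Lemma lsum_le g g' l : (forall x, In x l -> g x <= g' x) -> lsum g l <= lsum g' l.
Proof.
  induction l as [|a l IH]; simpl; intros H; [lra|].
  assert (g a <= g' a) by auto. assert (lsum g l <= lsum g' l) by auto. lra.
Qed.

Lemma lsum_add g g' l : lsum (fun x => g x + g' x) l = lsum g l + lsum g' l.
Proof. induction l as [|a l IH]; simpl; [|rewrite IH]; lra. Qed.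

Lemma lsum_scal c g l : lsum (fun x => c * g x) l = c * lsum g l.
Proof. induction l as [|a l IH]; simpl; [|rewrite IH]; lra. Qed.

Lemma lsum_nonneg g l : (forall x, 0 <= g x) -> 0 <= lsum g l.
Proof. intros H; induction l as [|a l IH]; simpl; [|specialize (H a)]; lra. Qed.

Lemma lsum_app g l l' : lsum g (l ++ l') = lsum g l + lsum g l'.
Proof. induction l as [|a l IH]; simpl; [|rewrite IH]; lra. Qed.

Lemma lsum_map (J : Type) (phi : J -> I) g (l : list J) :
  lsum g (map phi l) = lsum (fun x => g (phi x)) l.
Proof. induction l as [|a l IH]; simpl; [|rewrite IH]; lra. Qed.

Lemma lsum_filter g (b : I -> bool) l :
  (forall x, In x l -> b x = false -> g x = 0) -> lsum g (filter b l) = lsum g l.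
Proof.
  induction l as [|a l IH]; simpl; intros H; [reflexivity|].
  destruct (b a) eqn:E; simpl; rewrite IH by auto; [|rewrite (H a) by auto]; lra.
Qed.

Lemma lsum_remove g a l : NoDup l -> In a l ->
  lsum g l = g a + lsum g (remove (eq_decide I) a l).
Proof.
  induction l as [|b l IH]; intros Hn Hi; [destruct Hi|].
  inversion Hn as [|? ? Hb Hl]; subst.
  cbn [remove]. destruct (eq_decide I a b) as [->|Hab].
  - rewrite notin_remove by assumption. reflexivity.
  - destruct Hi as [->|Hi]; [congruence|]. simpl. rewrite (IH Hl Hi). lra.
Qed.

Lemma NoDup_remove_eq a l : NoDup l -> NoDup (remove (eq_decide I) a l).
Proof.
  induction l as [|b l IH]; intros Hn; simpl; [constructor|].
  inversion Hn; subst. destruct (eq_decide I a b); auto.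
  constructor; auto. intros Hb. apply in_remove in Hb. tauto.
Qed.

Lemma lsum_incl g l l' : (forall x, 0 <= g x) -> NoDup l -> NoDup l' -> incl l l' ->
  lsum g l <= lsum g l'.
Proof.
  intros Hg. revert l'. induction l as [|a l IH]; intros l' Hn Hn' Hi; simpl.
  - now apply lsum_nonneg.
  - inversion Hn as [|? ? Ha Hl]; subst.
    rewrite (lsum_remove g a l') by (auto; apply Hi; left; reflexivity).
    apply Rplus_le_compat_l, IH; auto using NoDup_remove_eq.
    intros x Hx. apply in_in_remove; [intros ->; contradiction | apply Hi; right; auto].
Qed.

Definition lunion l l' : list I := nodup (eq_decide I) (l ++ l').

Lemma lunion_spec l l' : NoDup (lunion l l') /\ incl l (lunion l l') /\ incl l' (lunion l l').
Proof.
  unfold lunion. split; [apply NoDup_nodup|].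
  split; intros x Hx; apply nodup_In, in_or_app; auto.
Qed.

Lemma lsum_count g l :
  lsum g l = lsum (fun y => INR (count_occ (eq_decide I) l y) * g y) (nodup (eq_decide I) l).
Proof.
  induction l as [|a l IH]; [reflexivity|].
  transitivity (g a + lsum g l); [reflexivity|]. rewrite IH. cbn [nodup].
  destruct (in_dec (eq_decide I) a l) as [Hi|Hi].
  - assert (Ha : In a (nodup (eq_decide I) l)) by now apply nodup_In.
    rewrite (lsum_remove _ a) by auto using NoDup_nodup.
    rewrite (lsum_remove _ a (nodup _ l)) by auto using NoDup_nodup.
    rewrite (count_occ_cons_eq _ l (eq_refl a)), S_INR.
    rewrite (lsum_ext (fun y => INR (count_occ (eq_decide I) (a :: l) y) * g y)
      (fun y => INR (count_occ (eq_decide I) l y) * g y)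
      (remove (eq_decide I) a (nodup (eq_decide I) l))); [lra|].
    intros x Hx. apply in_remove in Hx. rewrite count_occ_cons_neq; auto. intuition congruence.
  - rewrite lsum_cons, (count_occ_cons_eq _ l (eq_refl a)), S_INR.
    rewrite (proj1 (count_occ_not_In (eq_decide I) l a) Hi).
    rewrite (lsum_ext (fun y => INR (count_occ (eq_decide I) (a :: l) y) * g y)
      (fun y => INR (count_occ (eq_decide I) l y) * g y) (nodup (eq_decide I) l)).
    + simpl. lra.
    + intros x Hx. apply nodup_In in Hx. rewrite count_occ_cons_neq; auto. intros ->; contradiction.
Qed.

Lemma count_occ_map (J : Type) (phi : J -> I) (l : list J) y :
  count_occ (eq_decide I) (map phi l) y = length (filter (fun x => pdec (phi x = y)) l).
Proof.
  induction l as [|a l IH]; [reflexivity|]. simpl.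
  unfold pdec at 1. unfold eq_decide at 1.
  destruct (excluded_middle_informative (phi a = y)); simpl; rewrite IH; reflexivity.
Qed.

(** For nonnegative [g], bounded partial sums over duplicate-free lists amount to unconditional
    summability, with no enumeration of the index type. *)
Definition summable g : Prop := exists M, forall l, NoDup l -> lsum g l <= M.

(* Meaningful only for summable families; unspecified otherwise. *)
Definition total g : R :=
  epsilon (inhabits 0) (is_lub (fun s => exists l, NoDup l /\ s = lsum g l)).

Lemma total_lub g : summable g -> is_lub (fun s => exists l, NoDup l /\ s = lsum g l) (total g).
Proof.
  intros [M HM]. unfold total. apply epsilon_spec.
  destruct (completeness (fun s => exists l, NoDup l /\ s = lsum g l)) as [v Hv]; [| |now exists v].
  - exists M. intros s (l & Hl & ->). auto.
  - exists 0, nil. split; [constructor|reflexivity].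
Qed.

Lemma total_ge g l : summable g -> NoDup l -> lsum g l <= total g.
Proof. intros Hg Hl. apply (total_lub g Hg). now exists l. Qed.

Lemma total_least g M : summable g -> (forall l, NoDup l -> lsum g l <= M) -> total g <= M.
Proof. intros Hg H. apply (total_lub g Hg). intros s (l & Hl & ->). auto. Qed.

Lemma total_nonneg g : summable g -> 0 <= total g.
Proof. intros Hg. apply (total_ge g nil Hg). constructor. Qed.

Lemma total_approx g eps : summable g -> 0 < eps ->
  exists l, NoDup l /\ total g - eps < lsum g l.
Proof.
  intros Hg He. apply NNPP. intros Hn.
  assert (total g <= total g - eps); [|lra].
  apply total_least; auto. intros l Hl. apply Rnot_lt_le. intros H. apply Hn. now exists l.
Qed.

Lemma summable_tail_small g eps : (forall x, 0 <= g x) -> summable g -> 0 < eps ->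
  exists l0, forall l, NoDup l -> (forall x, In x l -> ~ In x l0) -> lsum g l <= eps.
Proof.
  intros Hp Hg He. destruct (total_approx g eps Hg He) as (l0 & Hl0 & H0).
  exists l0. intros l Hl Hd.
  assert (lsum g (l ++ l0) <= total g).
  { apply total_ge; auto. apply NoDup_app; auto. }
  rewrite lsum_app in H. lra.
Qed.

End Sums.

Arguments summable {I} g.
Arguments total {I} g.
Arguments lunion {I} l l'.

Lemma lsum_exchange (I J : Type) (g : I -> J -> R) (l : list I) (l' : list J) :
  lsum (fun x => lsum (g x) l') l = lsum (fun y => lsum (fun x => g x y) l) l'.
Proof.
  induction l as [|a l IH]; simpl.
  - induction l' as [|b l' IH']; simpl; [|rewrite <- IH']; lra.
  - rewrite IH, lsum_add. reflexivity.
Qed.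

(** Each value of [phi] occurs at most [C] times along [l], so grouping equal values costs a factor
    [C]. This is the form in which the bounded multiplicity of differences is used. *)
Lemma lsum_fiber_le (I J : Type) (phi : J -> I) (g : I -> R) (C : nat) (l : list J) :
  (forall x, 0 <= g x) -> summable g ->
  (forall y, (length (filter (fun x => pdec (phi x = y)) l) <= C)%nat) ->
  lsum (fun x => g (phi x)) l <= INR C * total g.
Proof.
  intros Hp Hg HC. rewrite <- lsum_map, lsum_count.
  apply Rle_trans with (lsum (fun y => INR C * g y) (nodup (eq_decide I) (map phi l))).
  - apply lsum_le. intros y _. apply Rmult_le_compat_r; auto.
    apply le_INR. rewrite count_occ_map. apply HC.
  - rewrite lsum_scal. apply Rmult_le_compat_l; [apply pos_INR|].
    apply total_ge; auto. apply NoDup_nodup.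
Qed.

(** One half of Tonelli for a finite outer list: each inner total is approximated by a finite sum,
    and the finite lists glue to one duplicate-free list of pairs. *)
Lemma lsum_total_le (I J : Type) (G : I * J -> R) (l : list I) eps :
  (forall x, summable (fun y => G (x, y))) -> NoDup l ->
  (forall L, NoDup L -> (forall p, In p L -> In (fst p) l) -> lsum G L <= eps) ->
  lsum (fun x => total (fun y => G (x, y))) l <= eps.
Proof.
  intros HG Hl Hb. apply le_epsilon. intros eta Heta.
  assert (H : forall eta, 0 < eta -> exists L, NoDup L /\ (forall p, In p L -> In (fst p) l) /\
    lsum (fun x => total (fun y => G (x, y))) l <= lsum G L + eta).
  { clear Hb eta Heta. induction l as [|a l IH]; intros eta Heta.
    - exists nil. split; [constructor|]. split; [intros p []|]. simpl. lra.
    - inversion Hl as [|? ? Ha Hl']; subst.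
      destruct (IH Hl' (eta / 2)) as (L & HL & Hin & HS); [lra|].
      destruct (total_approx J _ (eta / 2) (HG a)) as (l1 & Hl1 & H1); [lra|].
      exists (map (fun y => (a, y)) l1 ++ L). split; [|split].
      + apply NoDup_app; auto.
        * apply NoDup_map_NoDup_ForallPairs; auto. intros y y' _ _ E. congruence.
        * intros p Hp HpL. apply in_map_iff in Hp. destruct Hp as (y & <- & _).
          apply Hin in HpL. contradiction.
      + intros p Hp. apply in_app_or in Hp. destruct Hp as [Hp|Hp].
        * apply in_map_iff in Hp. destruct Hp as (y & <- & _). now left.
        * right; auto.
      + rewrite lsum_app, lsum_map. simpl. lra. }
  destruct (H eta Heta) as (L & HL & Hin & HS). specialize (Hb L HL Hin). lra.
Qed.

(** * Elementary real inequalities *)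

Lemma discriminant_nonpos (A B S : R) : 0 <= A ->
  (forall t, 0 <= t * t * A + 2 * t * S + B) -> S * S <= A * B.
Proof.
  intros HA H. destruct (Rle_lt_or_eq_dec 0 A HA) as [Hp|<-].
  - specialize (H (- (S / A))).
    replace (- (S / A) * - (S / A) * A + 2 * - (S / A) * S + B) with (B - S * S / A) in H
      by (field; lra).
    assert (A * (B - S * S / A) = A * B - S * S) by (field; lra). nra.
  (* With A = 0 the form is affine in t; for nonzero S the value of t chosen below makes it -1. *)
  - destruct (Req_dec S 0) as [->|HS]; [lra|].
    specialize (H (- (B + 1) / (2 * S))).
    replace (- (B + 1) / (2 * S) * (- (B + 1) / (2 * S)) * 0 + 2 * (- (B + 1) / (2 * S)) * S + B)
      with (-1) in H by (field; auto). lra.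
Qed.

Lemma inv_succ_pos n : 0 < / (INR n + 1).
Proof. apply Rinv_0_lt_compat. pose proof (pos_INR n). lra. Qed.

Lemma inv_succ_small eps : 0 < eps -> exists n, / (INR n + 1) < eps.
Proof.
  intros He. destruct (archimed_cor1 eps He) as (N & HN & HN').
  exists N. apply Rle_lt_trans with (/ INR N); auto.
  apply Rinv_le_contravar; [apply lt_0_INR; auto | lra].
Qed.

Lemma inv_succ_anti n p : (n <= p)%nat -> / (INR p + 1) <= / (INR n + 1).
Proof.
  intros H. apply Rinv_le_contravar; [pose proof (pos_INR n); lra|].
  apply le_INR in H. lra.
Qed.

(** * Inner product calculus *)

Definition Ci : Cx := mkCx 0 1.

Section InnerProduct.
Variable X : Hilbert.
Implicit Types x y z : X.

(** Real and imaginary parts are handled as separate real bilinear forms, so that [ring], [lra] and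
    [nra] apply. *)
Definition rip x y : R := Cre (hinner X x y).
Definition iip x y : R := Cim (hinner X x y).
Definition nsq x : R := rip x x.

Lemma rip_sym x y : rip x y = rip y x.
Proof. unfold rip. rewrite (hinner_conj X x y). reflexivity. Qed.
Lemma iip_sym x y : iip x y = - iip y x.
Proof. unfold iip. rewrite (hinner_conj X x y). simpl. ring. Qed.
Lemma iip_diag x : iip x x = 0.
Proof. assert (H := iip_sym x x). lra. Qed.

Lemma rip_add_l x y z : rip (hadd X x y) z = rip x z + rip y z.
Proof. unfold rip. rewrite hinner_add_l. reflexivity. Qed.
Lemma iip_add_l x y z : iip (hadd X x y) z = iip x z + iip y z.
Proof. unfold iip. rewrite hinner_add_l. reflexivity. Qed.
Lemma rip_scal_l a x y : rip (hscal X a x) y = Cre a * rip x y - Cim a * iip x y.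
Proof. unfold rip, iip. rewrite hinner_scal_l. reflexivity. Qed.
Lemma iip_scal_l a x y : iip (hscal X a x) y = Cre a * iip x y + Cim a * rip x y.
Proof. unfold rip, iip. rewrite hinner_scal_l. reflexivity. Qed.
Lemma rip_zero_l z : rip (hzero X) z = 0.
Proof. assert (H := rip_add_l (hzero X) (hzero X) z). rewrite hadd_0 in H. lra. Qed.
Lemma iip_zero_l z : iip (hzero X) z = 0.
Proof. assert (H := iip_add_l (hzero X) (hzero X) z). rewrite hadd_0 in H. lra. Qed.
Lemma rip_opp_l x z : rip (hopp X x) z = - rip x z.
Proof. assert (H := rip_add_l x (hopp X x) z). rewrite hadd_opp, rip_zero_l in H. lra. Qed.
Lemma iip_opp_l x z : iip (hopp X x) z = - iip x z.
Proof. assert (H := iip_add_l x (hopp X x) z). rewrite hadd_opp, iip_zero_l in H. lra. Qed.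

Lemma rip_add_r x y z : rip z (hadd X x y) = rip z x + rip z y.
Proof. rewrite !(rip_sym z). apply rip_add_l. Qed.
Lemma iip_add_r x y z : iip z (hadd X x y) = iip z x + iip z y.
Proof. rewrite !(iip_sym z), iip_add_l. ring. Qed.
Lemma rip_scal_r a x z : rip z (hscal X a x) = Cre a * rip z x + Cim a * iip z x.
Proof. rewrite !(rip_sym z), (iip_sym z), rip_scal_l. ring. Qed.
Lemma iip_scal_r a x z : iip z (hscal X a x) = Cre a * iip z x - Cim a * rip z x.
Proof. rewrite !(rip_sym z), !(iip_sym z), iip_scal_l. ring. Qed.
Lemma rip_zero_r z : rip z (hzero X) = 0.
Proof. rewrite rip_sym. apply rip_zero_l. Qed.
Lemma iip_zero_r z : iip z (hzero X) = 0.
Proof. rewrite iip_sym, iip_zero_l. ring. Qed.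
Lemma rip_opp_r x z : rip z (hopp X x) = - rip z x.
Proof. rewrite !(rip_sym z). apply rip_opp_l. Qed.
Lemma iip_opp_r x z : iip z (hopp X x) = - iip z x.
Proof. rewrite !(iip_sym z), iip_opp_l. ring. Qed.

Lemma nsq_nonneg x : 0 <= nsq x.
Proof. apply hinner_pos. Qed.

Lemma nsq_zero_inv x : nsq x = 0 -> x = hzero X.
Proof.
  intros H. apply hinner_def.
  assert (H' := iip_diag x). unfold nsq, rip, iip in *.
  destruct (hinner X x x); simpl in *; subst. reflexivity.
Qed.

Lemma hnorm_sq x : hnorm X x ^ 2 = nsq x.
Proof. unfold hnorm. rewrite pow2_sqrt; [reflexivity|apply hinner_pos]. Qed.

Lemma hnorm_nonneg x : 0 <= hnorm X x.
Proof. apply sqrt_pos. Qed.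

End InnerProduct.

Arguments rip {X} x y.
Arguments iip {X} x y.
Arguments nsq {X} x.

(** Reduces inner products of compound vectors to real polynomials in [rip] and [iip] of their
    constituents. *)
Ltac ipexpand :=
  unfold nsq, hsub;
  repeat rewrite ?rip_add_l, ?rip_add_r, ?rip_opp_l, ?rip_opp_r, ?rip_scal_l, ?rip_scal_r,
    ?rip_zero_l, ?rip_zero_r, ?iip_add_l, ?iip_add_r, ?iip_opp_l, ?iip_opp_r, ?iip_scal_l,
    ?iip_scal_r, ?iip_zero_l, ?iip_zero_r;
  cbn [Cre Cim RtoC C0 Defs.C1 Ci Cmul Cadd].

(** * Cauchy-Schwarz, convergence and linear combinations *)

Section HilbertGeometry.
Variable X : Hilbert.
Implicit Types x y z : X.

(** Testing with z = x - y gives zero norm. Real parts suffice, so vector identities reduce to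
    [ipexpand] and [ring]. *)
Lemma hext x y : (forall z, rip x z = rip y z) -> x = y.
Proof.
  intros H. assert (E : hsub X x y = hzero X).
  { apply nsq_zero_inv. unfold nsq, hsub at 1. rewrite rip_add_l, rip_opp_l, H. ring. }
  rewrite <- (hadd_0 X y), <- E. unfold hsub.
  rewrite (hadd_comm X x), hadd_assoc, hadd_opp, hadd_comm, hadd_0. reflexivity.
Qed.

Lemma nsq_sub_swap x y : nsq (hsub X x y) = nsq (hsub X y x).
Proof. ipexpand. rewrite (rip_sym X y x). ring. Qed.

Lemma cauchy_schwarz_rip x y : rip x y * rip x y <= nsq x * nsq y.
Proof.
  apply discriminant_nonpos; [apply nsq_nonneg|]. intros t.
  assert (H := nsq_nonneg X (hadd X (hscal X (RtoC t) x) y)). revert H.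
  ipexpand. rewrite (rip_sym X y x). intros H. lra.
Qed.

Lemma nsq_add_le x y : nsq (hadd X x y) <= 2 * nsq x + 2 * nsq y.
Proof.
  assert (H := nsq_nonneg X (hsub X x y)). revert H.
  ipexpand. rewrite (rip_sym X y x). intros H. lra.
Qed.

Lemma nsq_sub_le x y z : nsq (hsub X x z) <= 2 * nsq (hsub X x y) + 2 * nsq (hsub X y z).
Proof.
  replace (hsub X x z) with (hadd X (hsub X x y) (hsub X y z)); [apply nsq_add_le|].
  apply hext. intros w. ipexpand. ring.
Qed.

Lemma hnorm_lt_nsq x eps : 0 < eps -> (hnorm X x < eps <-> nsq x < eps * eps).
Proof.
  intros He. rewrite <- hnorm_sq. assert (H := hnorm_nonneg X x). split; nra.
Qed.

Lemma hnorm_le_nsq x eps : 0 < eps -> (hnorm X x <= eps <-> nsq x <= eps * eps).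
Proof.
  intros He. rewrite <- hnorm_sq. assert (H := hnorm_nonneg X x). split; nra.
Qed.

Lemma converges_nsq (u : nat -> X) y : converges X u y <->
  forall eps, 0 < eps -> exists N, forall n, (N <= n)%nat -> nsq (hsub X (u n) y) < eps.
Proof.
  split; intros H eps He.
  - destruct (H (sqrt eps)) as [N HN]; [now apply sqrt_lt_R0|].
    exists N. intros n Hn. specialize (HN n Hn).
    apply hnorm_lt_nsq in HN; [|now apply sqrt_lt_R0]. rewrite sqrt_sqrt in HN; lra.
  - destruct (H (eps * eps)) as [N HN]; [nra|].
    exists N. intros n Hn. apply hnorm_lt_nsq; auto.
Qed.

Lemma hilbert_complete (u : nat -> X) :
  (forall eps, 0 < eps -> exists N, forall n p, (N <= n)%nat -> (N <= p)%nat ->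
     nsq (hsub X (u n) (u p)) < eps) ->
  exists y, converges X u y.
Proof.
  intros H. apply (hcomplete X u). intros eps He.
  destruct (H (eps * eps)) as [N HN]; [nra|].
  exists N. intros n p Hn Hp. apply (hnorm_lt_nsq (hsub X (u n) (u p)) eps He). auto.
Qed.

Lemma converges_rip (u : nat -> X) y z : converges X u y ->
  Un_cv (fun n => rip (u n) z) (rip y z).
Proof.
  intros Hu eps He. assert (Hz := nsq_nonneg X z).
  destruct (proj1 (converges_nsq u y) Hu (eps * eps / (nsq z + 1))) as [N HN].
  { apply Rdiv_lt_0_compat; nra. }
  exists N. intros n Hn. specialize (HN n Hn).
  assert (HC := cauchy_schwarz_rip (hsub X (u n) y) z).
  assert (E : rip (hsub X (u n) y) z = rip (u n) z - rip y z) by (ipexpand; ring).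
  rewrite E in HC. unfold R_dist. set (d := rip (u n) z - rip y z) in *.
  assert (Hm : nsq (hsub X (u n) y) * (nsq z + 1) < eps * eps).
  { apply Rmult_lt_reg_r with (/ (nsq z + 1)); [apply Rinv_0_lt_compat; lra|].
    rewrite Rmult_assoc, Rinv_r by lra. rewrite Rmult_1_r. exact HN. }
  assert (Hq := nsq_nonneg X (hsub X (u n) y)).
  assert (d * d < eps * eps) by nra.
  apply Rabs_def1; nra.
Qed.

Lemma converges_iip (u : nat -> X) y z : converges X u y ->
  Un_cv (fun n => iip (u n) z) (iip y z).
Proof.
  intros Hu. assert (E : forall x, iip x z = rip x (hscal X Ci z)) by (intros; ipexpand; ring).
  rewrite E. intros eps He. destruct (converges_rip u y (hscal X Ci z) Hu eps He) as [N HN].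
  exists N. intros n Hn. rewrite E. auto.
Qed.

(** |u n - y|^2 = 1 + |y|^2 - 2 Re<u n, y> tends both to 0 and to 1 - |y|^2. *)
Lemma converges_unit (u : nat -> X) y : converges X u y -> (forall n, nsq (u n) = 1) -> nsq y = 1.
Proof.
  intros Hu H1. apply NNPP. intros Hne.
  assert (Hd : 0 < Rabs (nsq y - 1)) by (apply Rabs_pos_lt; lra).
  set (d := Rabs (nsq y - 1)) in *.
  destruct (converges_rip u y y Hu (d / 8)) as [N HN]; [lra|].
  destruct (proj1 (converges_nsq u y) Hu (d / 8)) as [N' HN']; [lra|].
  specialize (HN (N + N')%nat ltac:(lia)). specialize (HN' (N + N')%nat ltac:(lia)).
  specialize (H1 (N + N')%nat). set (v := u (N + N')%nat) in *.
  assert (E : nsq (hsub X v y) = nsq v + nsq y - 2 * rip v y).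
  { ipexpand. rewrite (rip_sym X y v). ring. }
  unfold R_dist in HN. fold (nsq y) in HN. apply Rabs_def2 in HN.
  assert (Hq := nsq_nonneg X (hsub X v y)).
  unfold d, Rabs in *. destruct (Rcase_abs (nsq y - 1)); lra.
Qed.

Section Lincomb.
Variables (J : Type) (v : J -> X).

Lemma lincomb_app l l' : lincomb X v (l ++ l') = hadd X (lincomb X v l) (lincomb X v l').
Proof.
  induction l as [|p l IH]; cbn [app lincomb fold_right].
  - now rewrite hadd_comm, hadd_0.
  - unfold lincomb in IH. rewrite IH. unfold lincomb. apply hadd_assoc.
Qed.

Lemma lincomb_scal a l :
  lincomb X v (map (fun p => (Cmul a (fst p), snd p)) l) = hscal X a (lincomb X v l).
Proof.
  induction l as [|p l IH]; cbn [map lincomb fold_right fst snd].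
  - apply hext. intros z. ipexpand. ring.
  - unfold lincomb in IH. rewrite IH. rewrite hscal_distr_l, hscal_assoc. reflexivity.
Qed.

Lemma lincomb_single a j : lincomb X v ((a, j) :: nil) = hscal X a (v j).
Proof. unfold lincomb. simpl. apply hadd_0. Qed.

Lemma lincomb_orth l z : (forall p, In p l -> rip (v (snd p)) z = 0 /\ iip (v (snd p)) z = 0) ->
  rip (lincomb X v l) z = 0.
Proof.
  induction l as [|p l IH]; intros H; cbn [lincomb fold_right].
  - apply rip_zero_l.
  - rewrite rip_add_l, rip_scal_l. destruct (H p (or_introl eq_refl)) as [-> ->].
    unfold lincomb in IH. rewrite IH by (intros; apply H; right; auto). ring.
Qed.
End Lincomb.

End HilbertGeometry.

(** * Projection theorem in l2(I, X) *)

Section L2Projection.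
Variables (X : Hilbert) (I : Type).
Implicit Types g h phi : I -> X.

Definition l2 phi : Prop := summable (fun b => nsq (phi b)).

(* The unconditionally convergent series of the [Re <h b, phi b>] has sum 0. *)
Definition l2_orth h phi : Prop := forall eps, 0 < eps -> exists l0, forall l,
  NoDup l -> incl l0 l -> Rabs (lsum (fun b => rip (h b) (phi b)) l) <= eps.

Lemma l2_sub g phi : l2 g -> l2 phi -> l2 (fun b => hsub X (g b) (phi b)).
Proof.
  intros [M HM] [M' HM']. exists (2 * M + 2 * M'). intros l Hl.
  specialize (HM l Hl). specialize (HM' l Hl).
  apply Rle_trans with (lsum (fun b => 2 * nsq (g b) + 2 * nsq (phi b)) l).
  - apply lsum_le. intros b _. unfold hsub.
    eapply Rle_trans; [apply nsq_add_le|]. right. ipexpand. ring.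
  - rewrite lsum_add, !lsum_scal. lra.
Qed.

Lemma pointwise_lsum_limit (u : nat -> I -> X) h (l : list I) eps :
  (forall b, converges X (fun n => u n b) (h b)) -> 0 < eps ->
  exists N, forall n, (N <= n)%nat -> lsum (fun b => nsq (hsub X (u n b) (h b))) l <= eps.
Proof.
  intros Hu. revert eps. induction l as [|b l IH]; intros eps He.
  - exists 0%nat. intros n _. simpl. lra.
  - destruct (IH (eps / 2)) as [N HN]; [lra|].
    destruct (proj1 (converges_nsq X _ _) (Hu b) (eps / 2)) as [N' HN']; [lra|].
    exists (N + N')%nat. intros n Hn. rewrite lsum_cons.
    specialize (HN n ltac:(lia)). specialize (HN' n ltac:(lia)). cbv beta in HN'. lra.
Qed.

(** A real subspace, not assumed closed: the projection is onto its closure. Complex orthogonality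
    is recovered by testing against complex multiples. *)
Variable D : (I -> X) -> Prop.
Hypothesis D_l2 : forall phi, D phi -> l2 phi.
Hypothesis D_zero : D (fun _ => hzero X).
Hypothesis D_add : forall phi psi, D phi -> D psi -> D (fun b => hadd X (phi b) (psi b)).
Hypothesis D_scal : forall r phi, D phi -> D (fun b => hscal X (RtoC r) (phi b)).

Variable g : I -> X.
Hypothesis g_l2 : l2 g.

Let N2 phi := total (fun b => nsq (hsub X (g b) (phi b))).

Lemma sub_summable phi : D phi -> summable (fun b => nsq (hsub X (g b) (phi b))).
Proof. intros H. apply l2_sub; auto. Qed.

Lemma l2_distance : exists d, (forall phi, D phi -> d <= N2 phi) /\
  forall eps, 0 < eps -> exists phi, D phi /\ N2 phi < d + eps.
Proof.
  destruct (completeness (fun s => exists phi, D phi /\ s = - N2 phi)) as [v [Hv1 Hv2]].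
  - exists 0. intros s (phi & Hphi & ->).
    assert (H := total_nonneg _ _ (sub_summable phi Hphi)). fold (N2 phi) in H. lra.
  - exists (- N2 (fun _ => hzero X)). exists (fun _ => hzero X). auto.
  - exists (- v). split.
    + intros phi Hphi. assert (- N2 phi <= v) by (apply Hv1; now exists phi). lra.
    + intros eps He. apply NNPP. intros Hn.
      assert (v <= v - eps); [|lra]. apply Hv2. intros s (phi & Hphi & ->).
      apply Rnot_lt_le. intros H. apply Hn. exists phi. split; auto. lra.
Qed.

(* Parallelogram law, evaluated at the midpoint of two near-minimizers. *)
Lemma near_minimizers_close d phi psi e e' (l : list I) :
  (forall phi, D phi -> d <= N2 phi) -> D phi -> D psi -> NoDup l ->
  N2 phi <= d + e -> N2 psi <= d + e' ->
  lsum (fun b => nsq (hsub X (phi b) (psi b))) l <= 2 * e + 2 * e'.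
Proof.
  intros Hd Hphi Hpsi Hl He He'.
  set (mid := fun b => hscal X (RtoC (/ 2)) (hadd X (phi b) (psi b))).
  assert (Hmid : D mid).
  { apply (D_scal (/ 2) (fun b => hadd X (phi b) (psi b))). auto. }
  specialize (Hd mid Hmid).
  assert (Hm : N2 mid <=
    (2 * N2 phi + 2 * N2 psi - lsum (fun b => nsq (hsub X (phi b) (psi b))) l) / 4).
  { apply total_least; [now apply sub_summable|]. intros l1 Hl1.
    (* Both finite sums are enlarged to a common list, where the parallelogram identity holds term
       by term. *)
    destruct (lunion_spec I l l1) as (Hu & Hul & Hul1). set (L := lunion l l1) in *.
    assert (A1 := lsum_incl I (fun b => nsq (hsub X (phi b) (psi b))) l L
                    (fun b => nsq_nonneg _ _) Hl Hu Hul).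
    assert (A2 := lsum_incl I (fun b => nsq (hsub X (g b) (mid b))) l1 L
                    (fun b => nsq_nonneg _ _) Hl1 Hu Hul1).
    assert (B1 := total_ge I _ L (sub_summable phi Hphi) Hu). fold (N2 phi) in B1.
    assert (B2 := total_ge I _ L (sub_summable psi Hpsi) Hu). fold (N2 psi) in B2.
    assert (E : lsum (fun b => nsq (hsub X (phi b) (psi b)) + 4 * nsq (hsub X (g b) (mid b))) L
      = lsum (fun b => 2 * nsq (hsub X (g b) (phi b)) + 2 * nsq (hsub X (g b) (psi b))) L).
    { apply lsum_ext. intros b _. unfold mid. ipexpand.
      rewrite !(rip_sym X (phi b) (g b)), !(rip_sym X (psi b) (g b)), (rip_sym X (psi b) (phi b)).
      field. }
    rewrite !lsum_add, !lsum_scal in E. lra. }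
  lra.
Qed.

(** [h] is g minus its projection onto the closure of [D]: the limit of g - p n along a minimizing
    sequence, which is Cauchy by the parallelogram law. Orthogonality is the vanishing of the first
    variation of the distance. *)
Theorem l2_projection : exists h, l2 h /\
  (forall eps, 0 < eps -> exists phi, D phi /\ forall l, NoDup l ->
     lsum (fun b => nsq (hsub X (hsub X (g b) (phi b)) (h b))) l <= eps) /\
  (forall phi, D phi -> l2_orth h phi).
Proof.
  destruct l2_distance as (d & Hd & Happ).
  assert (Hch : forall n, exists phi, D phi /\ N2 phi < d + / (INR n + 1)).
  { intros n. apply Happ, inv_succ_pos. }
  set (p := fun n => proj1_sig (constructive_indefinite_description _ (Hch n))).
  assert (Hp : forall n, D (p n) /\ N2 (p n) < d + / (INR n + 1)).
  { intros n. exact (proj2_sig (constructive_indefinite_description _ (Hch n))). }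
  clearbody p. set (u := fun n b => hsub X (g b) (p n b)).
  assert (Hclose : forall n k l, NoDup l ->
    lsum (fun b => nsq (hsub X (u n b) (u k b))) l <= 2 * / (INR n + 1) + 2 * / (INR k + 1)).
  { intros n k l Hl. destruct (Hp n) as [Dn Nn], (Hp k) as [Dk Nk].
    rewrite (lsum_ext I _ (fun b => nsq (hsub X (p n b) (p k b)))).
    - apply near_minimizers_close with d; auto; lra.
    - intros b _. unfold u. ipexpand.
      rewrite !(rip_sym X (p n b) (g b)), !(rip_sym X (p k b) (g b)). ring. }
  assert (Hlim : forall b, exists y, converges X (fun n => u n b) y).
  { intros b. apply hilbert_complete. intros eps He.
    destruct (inv_succ_small (eps / 4)) as [N HN]; [lra|].
    exists N. intros n k Hn Hk.
    assert (H := Hclose n k (b :: nil) ltac:(constructor; [intros []|constructor])).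
    simpl in H. apply inv_succ_anti in Hn, Hk. lra. }
  set (h := fun b => proj1_sig (constructive_indefinite_description _ (Hlim b))).
  assert (Hh : forall b, converges X (fun n => u n b) (h b)).
  { intros b. exact (proj2_sig (constructive_indefinite_description _ (Hlim b))). }
  clearbody h.
  (* With e = 1/(n+1) and an intermediate k >= n, the bound is 2(2e + 2e) + 2(e/2) = 9e. *)
  assert (Huh : forall n l, NoDup l ->
    lsum (fun b => nsq (hsub X (u n b) (h b))) l <= 9 * / (INR n + 1)).
  { intros n l Hl. assert (Hpos := inv_succ_pos n).
    destruct (pointwise_lsum_limit u h l (/ (INR n + 1) / 2) Hh) as [N HN]; [lra|].
    set (k := (N + n)%nat). specialize (HN k ltac:(unfold k; lia)).
    assert (Hk := inv_succ_anti n k ltac:(unfold k; lia)).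
    assert (H1 := Hclose n k l Hl).
    apply Rle_trans with (lsum (fun b => 2 * nsq (hsub X (u n b) (u k b)) +
                                         2 * nsq (hsub X (u k b) (h b))) l).
    - apply lsum_le. intros b _. apply nsq_sub_le.
    - rewrite lsum_add, !lsum_scal. lra. }
  exists h. split; [|split].
  - exists (18 * / (INR 0 + 1) + 2 * N2 (p 0%nat)). intros l Hl.
    assert (A1 := Huh 0%nat l Hl).
    assert (A2 := total_ge I _ l (sub_summable (p 0%nat) (proj1 (Hp 0%nat))) Hl).
    fold (N2 (p 0%nat)) in A2.
    apply Rle_trans with (lsum (fun b => 2 * nsq (hsub X (u 0%nat b) (h b)) +
                                         2 * nsq (hsub X (g b) (p 0%nat b))) l).
    + apply lsum_le. intros b _. rewrite (nsq_sub_swap X (u 0%nat b)).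
      replace (h b) with (hadd X (hsub X (h b) (u 0%nat b)) (hsub X (g b) (p 0%nat b))) at 1.
      * apply nsq_add_le.
      * apply hext. intros z. unfold u. ipexpand. ring.
    + rewrite lsum_add, !lsum_scal. lra.
  - intros eps He. destruct (inv_succ_small (eps / 9)) as [N HN]; [lra|].
    exists (p N). split; [apply Hp|]. intros l Hl. specialize (Huh N l Hl).
    unfold u in Huh. lra.
  - intros phi Hphi.
    assert (HN := total_nonneg I _ (D_l2 phi Hphi)).
    set (Nf := total (fun b => nsq (phi b))) in *.
    (* first variation of the squared distance in the direction [t phi] *)
    assert (Hvar : forall t, t <> 0 -> exists l0, forall l, NoDup l -> incl l0 l ->
      2 * t * lsum (fun b => rip (h b) (phi b)) l <= t * t * (1 + 2 * Nf)).
    (* The errors add up to 11e: e from [l0], e from the near-minimizer [p n], and 9e from the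
       distance between [u n] and [h]. *)
    { intros t Ht. assert (Htt : 0 < t * t) by nra.
      destruct (inv_succ_small (t * t / 11)) as [n Hn]; [lra|].
      assert (Hpos := inv_succ_pos n). set (e := / (INR n + 1)) in *.
      destruct (Hp n) as [Dn Nn]. fold e in Nn.
      set (psi := fun b => hadd X (p n b) (hscal X (RtoC t) (phi b))).
      assert (Hpsi : D psi).
      { apply (D_add (p n) (fun b => hscal X (RtoC t) (phi b))); auto. }
      destruct (total_approx I _ e (sub_summable psi Hpsi) Hpos) as (l0 & Hl0 & Hs).
      fold (N2 psi) in Hs. assert (Hdpsi := Hd psi Hpsi).
      exists l0. intros l Hl Hi.
      assert (A1 := lsum_incl I _ l0 l (fun b => nsq_nonneg X (hsub X (g b) (psi b))) Hl0 Hl Hi).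
      cbv beta in A1.
      assert (A2 := total_ge I _ l (sub_summable (p n) Dn) Hl). fold (N2 (p n)) in A2.
      assert (A3 := total_ge I _ l (D_l2 phi Hphi) Hl). fold Nf in A3.
      assert (A4 := Huh n l Hl). fold e in A4.
      assert (E : lsum (fun b => nsq (hsub X (g b) (psi b)) + 2 * t * rip (h b) (phi b)) l <=
        lsum (fun b => nsq (hsub X (g b) (p n b)) +
               (nsq (hsub X (u n b) (h b)) + 2 * (t * t) * nsq (phi b))) l).
      (* Termwise this is |u n b - h b + t phi b|^2 >= 0. *)
      { apply lsum_le. intros b _.
        assert (H := nsq_nonneg X (hadd X (hsub X (u n b) (h b)) (hscal X (RtoC t) (phi b)))).
        revert H. unfold psi, u. ipexpand.
        rewrite !(rip_sym X (phi b)), !(rip_sym X (h b) (g b)), !(rip_sym X (p n b) (g b)),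
          !(rip_sym X (h b) (p n b)).
        intros H. lra. }
      rewrite !lsum_add, !lsum_scal in E. nra. }
    (* For this t, the bounds at t and at -t give |S| <= eps/2. *)
    intros eps He. set (t := eps / (1 + 2 * Nf)).
    assert (Ht : 0 < t) by (apply Rdiv_lt_0_compat; lra).
    assert (Et : t * (1 + 2 * Nf) = eps) by (unfold t; field; lra).
    destruct (Hvar t) as [l1 H1]; [lra|]. destruct (Hvar (- t)) as [l2 H2]; [lra|].
    exists (l1 ++ l2). intros l Hl Hi. apply incl_app_inv in Hi. destruct Hi as [Hi1 Hi2].
    specialize (H1 l Hl Hi1). specialize (H2 l Hl Hi2).
    set (S := lsum (fun b => rip (h b) (phi b)) l) in *.
    replace (t * t * (1 + 2 * Nf)) with (t * eps) in H1 by (rewrite <- Et; ring).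
    replace (- t * - t * (1 + 2 * Nf)) with (t * eps) in H2 by (rewrite <- Et; ring).
    apply Rabs_le. split; nra.
Qed.

End L2Projection.

Arguments l2 {X I} phi.
Arguments l2_orth {X I} h phi.

(** * Orthogonal projection onto the closed span of a family *)

Section FamilyProjection.
Variables (X : Hilbert) (J : Type) (w : J -> X).

Definition perp (y : X) : Prop := forall j, rip y (w j) = 0 /\ iip y (w j) = 0.
(** The double orthogonal complement stands for the closed linear span of [w]. Real parts suffice,
    since [perp] is stable under multiplication by i. *)
Definition biperp (p : X) : Prop := forall y, perp y -> rip p y = 0.

Lemma perp_add x y : perp x -> perp y -> perp (hadd X x y).
Proof. intros Hx Hy j. destruct (Hx j), (Hy j). ipexpand. split; lra. Qed.

Lemma perp_scal a x : perp x -> perp (hscal X a x).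
Proof. intros Hx j. destruct (Hx j) as [E E']. ipexpand. rewrite E, E'. split; ring. Qed.

Lemma biperp_add x y : biperp x -> biperp y -> biperp (hadd X x y).
Proof. intros Hx Hy z Hz. rewrite rip_add_l, (Hx z Hz), (Hy z Hz). ring. Qed.

Lemma biperp_iip p y : biperp p -> perp y -> iip p y = 0.
Proof.
  intros Hp Hy. specialize (Hp _ (perp_scal Ci y Hy)). revert Hp. ipexpand. intros. lra.
Qed.

Lemma biperp_scal a x : biperp x -> biperp (hscal X a x).
Proof.
  intros Hx y Hy. rewrite rip_scal_l, (biperp_iip x y Hx Hy), (Hx y Hy). ring.
Qed.

Lemma biperp_perp_zero x : biperp x -> perp x -> x = hzero X.
Proof. intros H H'. apply nsq_zero_inv. exact (H x H'). Qed.

Lemma biperp_converges (u : nat -> X) y : converges X u y -> (forall n, biperp (u n)) -> biperp y.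
Proof.
  intros Hu Hb z Hz. apply (UL_sequence (fun n => rip (u n) z)); [now apply converges_rip|].
  intros eps He. exists 0%nat. intros n _. rewrite (Hb n z Hz). unfold R_dist.
  rewrite Rminus_diag, Rabs_R0. exact He.
Qed.

(** The l2 projection theorem over a one-point index type, with [D] the finite linear combinations
    of [w]; [h tt] is the orthogonal component of [x]. *)
Lemma biperp_decomposition x : exists p, biperp p /\ perp (hsub X x p).
Proof.
  set (D := fun phi : unit -> X => exists L, phi = fun _ => lincomb X w L).
  assert (Hl2 : forall phi : unit -> X, l2 phi).
  { intros phi. exists (nsq (phi tt)). intros l Hl.
    apply Rle_trans with (lsum (fun b => nsq (phi b)) (tt :: nil)).
    - apply lsum_incl; auto using nsq_nonneg.
      + constructor; [intros []|constructor].
      + intros [] _. now left.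
    - simpl. lra. }
  destruct (l2_projection X unit D) with (g := fun _ : unit => x) as (h & _ & Happ & Horth).
  { intros phi _. apply Hl2. }
  { exists nil. reflexivity. }
  { intros phi psi [L ->] [L' ->]. exists (L ++ L'). apply functional_extensionality. intros _.
    now rewrite lincomb_app. }
  { intros r phi [L ->]. exists (map (fun p => (Cmul (RtoC r) (fst p), snd p)) L).
    apply functional_extensionality. intros _. now rewrite lincomb_scal. }
  { apply Hl2. }
  assert (Hperp : perp (h tt)).
  { assert (H : forall a j, rip (h tt) (hscal X a (w j)) = 0).
    { intros a j. apply cond_eq. intros eps He. rewrite Rminus_0_r.
      destruct (Horth (fun _ => lincomb X w ((a, j) :: nil)) (ex_intro _ _ eq_refl) (eps / 2))
        as [l0 H0]; [lra|].
      specialize (H0 (tt :: nil) ltac:(constructor; [intros []|constructor])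
        ltac:(intros [] _; now left)).
      rewrite lsum_cons, lincomb_single in H0. simpl in H0. rewrite Rplus_0_r in H0. lra. }
    intros j. assert (H1 := H Defs.C1 j). assert (H2 := H Ci j). revert H1 H2. ipexpand.
    intros. split; lra. }
  exists (hsub X x (h tt)). split.
  - intros y Hy. set (z := hsub X x (h tt)).
    (* [z] is a limit of combinations of the [w j], all orthogonal to [y]; Cauchy-Schwarz controls
       the error. *)
    assert (Hz : forall eps, 0 < eps -> rip z y * rip z y <= eps * nsq y).
    { intros eps He. destruct (Happ eps He) as (phi & (L & ->) & HL).
      specialize (HL (tt :: nil) ltac:(constructor; [intros []|constructor])).
      simpl in HL. rewrite Rplus_0_r in HL.
      assert (E : rip z y = rip (hsub X (hsub X x (lincomb X w L)) (h tt)) y).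
      { unfold z. ipexpand. rewrite (lincomb_orth X J w L y); [ring|].
        intros p _. destruct (Hy (snd p)). rewrite rip_sym, iip_sym. split; lra. }
      rewrite E. eapply Rle_trans; [apply cauchy_schwarz_rip|].
      apply Rmult_le_compat_r; [apply nsq_nonneg | exact HL]. }
    assert (Hy0 := nsq_nonneg X y).
    assert (Hle : rip z y * rip z y <= 0).
    { apply le_epsilon. intros eps He. specialize (Hz (eps / (nsq y + 1))).
      assert (0 < eps / (nsq y + 1)) by (apply Rdiv_lt_0_compat; lra).
      assert (eps / (nsq y + 1) * (nsq y + 1) = eps) by (field; lra).
      specialize (Hz H). nra. }
    nra.
  - replace (hsub X x (hsub X x (h tt))) with (h tt); auto.
    apply hext. intros y. ipexpand. ring.
Qed.

Theorem family_projection : exists P : X -> X, orth_projection X P /\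
  (forall x, biperp (P x)) /\ (forall x, perp (hsub X x (P x))).
Proof.
  set (P := fun x => proj1_sig (constructive_indefinite_description _ (biperp_decomposition x))).
  assert (HP : forall x, biperp (P x) /\ perp (hsub X x (P x))).
  { intros x. exact (proj2_sig (constructive_indefinite_description _ (biperp_decomposition x))). }
  clearbody P.
  (* Uniqueness of the decomposition yields additivity, homogeneity and idempotence of [P]. *)
  assert (Huniq : forall x p, biperp p -> perp (hsub X x p) -> P x = p).
  { intros x p Hp Hxp. destruct (HP x) as [H1 H2].
    assert (E : hadd X (P x) (hscal X (RtoC (-1)) p) = hzero X).
    { apply biperp_perp_zero; auto using biperp_add, biperp_scal.
      replace (hadd X (P x) (hscal X (RtoC (-1)) p)) with
        (hadd X (hsub X x p) (hscal X (RtoC (-1)) (hsub X x (P x)))).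
      - apply perp_add; auto using perp_scal.
      - apply hext. intros z. ipexpand. ring. }
    apply hext. intros z. assert (Ez : rip (hadd X (P x) (hscal X (RtoC (-1)) p)) z = 0).
    { rewrite E. apply rip_zero_l. }
    revert Ez. ipexpand. intros. lra. }
  exists P. split; [|split; intros x; apply HP].
  (* Both sides of self-adjointness reduce to <P x, P y>, since y - P y is orthogonal to P x. *)
  assert (Hself : forall x y, hinner X (P x) y = hinner X (P x) (P y)).
  { intros x y. destruct (HP x) as [H1 _], (HP y) as [_ H2].
    assert (E1 := H1 _ H2). assert (E2 := biperp_iip _ _ H1 H2). revert E1 E2. ipexpand.
    unfold rip, iip. destruct (hinner X (P x) y), (hinner X (P x) (P y)). simpl. intros.
    f_equal; lra. }
  split; [|split; [|split]].
  - intros x y. destruct (HP x) as [H1 H2], (HP y) as [H3 H4].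
    apply Huniq; [now apply biperp_add|].
    replace (hsub X (hadd X x y) (hadd X (P x) (P y))) with
      (hadd X (hsub X x (P x)) (hsub X y (P y))); [now apply perp_add|].
    apply hext. intros z. ipexpand. ring.
  - intros a x. destruct (HP x) as [H1 H2]. apply Huniq; [now apply biperp_scal|].
    replace (hsub X (hscal X a x) (hscal X a (P x))) with
      (hscal X a (hsub X x (P x))); [now apply perp_scal|].
    apply hext. intros z. ipexpand. ring.
  - intros x. apply Huniq; [apply HP|].
    intros j. ipexpand. split; ring.
  - intros x y. rewrite (hinner_conj X (P y) x), (Hself x y), (Hself y x). apply hinner_conj.
Qed.

End FamilyProjection.

(** * Multi-indices *)

(** Iterates the inverse Cantor pairing, so that every multi-index lies among the first n for large
    n; the compactness argument exhausts the multi-indices in this order. *)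
Fixpoint multi_enum (m n : nat) : multi m :=
  match m with
  | O => fun _ => O
  | S m' => fun j => Fin.caseS' j (fun _ => nat) (fst (Cantor.of_nat n))
                       (multi_enum m' (snd (Cantor.of_nat n)))
  end.

Lemma multi_enum_surj (m : nat) (b : multi m) : exists n, multi_enum m n = b.
Proof.
  induction m as [|m IH].
  - exists 0%nat. apply functional_extensionality. intros j.
    exact (Fin.case0 (fun j => multi_enum 0 0 j = b j) j).
  - destruct (IH (fun j => b (Fin.FS j))) as [n Hn].
    exists (Cantor.to_nat (b Fin.F1, n)). apply functional_extensionality. intros j.
    cbn [multi_enum]. rewrite Cantor.cancel_of_to. cbn [fst snd]. rewrite Hn.
    now apply (Fin.caseS' j (fun j => Fin.caseS' j (fun _ => nat) (b Fin.F1)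
      (fun j => b (Fin.FS j)) = b j)).
Qed.

Lemma eventually_all_coordinates (m : nat) (Q : Fin.t m -> nat -> Prop) :
  (forall j, exists K, forall k, (K <= k)%nat -> Q j k) ->
  exists K, forall k, (K <= k)%nat -> forall j, Q j k.
Proof.
  induction m as [|m IH]; intros H.
  - exists 0%nat. intros k _ j. exact (Fin.case0 (fun j => Q j k) j).
  - destruct (IH (fun j => Q (Fin.FS j))) as [K HK]; [intros j; apply H|].
    destruct (H Fin.F1) as [K' HK']. exists (K + K')%nat. intros k Hk j.
    apply (Fin.caseS' j (fun j => Q j k)); [apply HK'; lia | intros j'; apply HK; lia].
Qed.

Lemma prefix_bounded (x : nat -> nat) (k : nat) :
  exists M, forall i, (i <= k)%nat -> (x i <= M)%nat.
Proof.
  induction k as [|k [M HM]].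
  - exists (x 0%nat). intros i Hi. replace i with 0%nat by lia. lia.
  - exists (M + x (S k))%nat. intros i Hi. destruct (Nat.eq_dec i (S k)) as [->|Hne]; [lia|].
    specialize (HM i ltac:(lia)). lia.
Qed.

(** Past [K] each step gains at least M + 1, while the values up to [K] stay below a bound B; after
    B + 1 further steps x k exceeds B + M. *)
Lemma gaps_separate (x : nat -> nat) :
  (forall M : Z, exists K, forall k, (K <= k)%nat ->
     (M <= Z.of_nat (x (S k)) - Z.of_nat (x k))%Z) ->
  forall M : nat, exists K, forall k, (K <= k)%nat ->
    (M <= x k)%nat /\ forall i, (i < k)%nat -> (x i + M < x k)%nat.
Proof.
  intros H M. destruct (H (Z.of_nat (M + 1))) as [K HK].
  assert (Hstep : forall t i, (K <= i)%nat -> (x i + t * (M + 1) <= x (i + t))%nat).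
  { induction t as [|t IH]; intros i Hi.
    - rewrite (Nat.add_0_r i). lia.
    - specialize (IH i Hi). specialize (HK (i + t)%nat ltac:(lia)).
      rewrite (Nat.add_succ_r i t). lia. }
  destruct (prefix_bounded x K) as [B HB].
  exists (K + B + 1)%nat. intros k Hk.
  assert (Hfar : (B + M + 1 <= x k)%nat).
  { specialize (Hstep (k - K)%nat K ltac:(lia)). replace (K + (k - K))%nat with k in Hstep by lia.
    nia. }
  split; [lia|]. intros i Hi. destruct (le_lt_dec i K) as [Hl|Hg].
  - specialize (HB i Hl). lia.
  - specialize (Hstep (k - i)%nat i ltac:(lia)). replace (i + (k - i))%nat with k in Hstep by lia.
    nia.
Qed.

Lemma in_H2_l2 (X : Hilbert) (m : nat) (f : multi m -> X) : in_H2 X m f <-> l2 f.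
Proof.
  assert (E : forall l, fold_right (fun a s => hnorm X (f a) ^ 2 + s) 0 l
                        = lsum (fun b => nsq (f b)) l).
  { intros l. apply (lsum_ext _ (fun a => hnorm X (f a) ^ 2)). intros b _. apply hnorm_sq. }
  unfold in_H2, l2, summable. split; intros [M HM]; exists M; intros l Hl; specialize (HM l Hl);
    rewrite E in *; exact HM.
Qed.

(** * Vectors orthogonal to all backward shifts *)

Section Residual.
Variables (X : Hilbert) (m : nat) (f : multi m -> X) (alpha : nat -> multi m) (h : multi m -> X).

Hypothesis f_l2 : l2 f.
Hypothesis alpha_inj : forall k k', alpha k = alpha k' -> k = k'.
Hypothesis alpha_spec : forall beta, in_spectrum X m f beta <-> exists k, alpha k = beta.
Variable C : nat.
Hypothesis few_differences : forall beta : Fin.t m -> Z,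
  forall l : list (multi m * multi m), NoDup l ->
    (forall p, In p l ->
       in_spectrum X m f (fst p) /\ in_spectrum X m f (snd p) /\ fst p <> snd p /\
       (forall j, (Z.of_nat (fst p j) - Z.of_nat (snd p j))%Z = beta j)) ->
    (length l <= C)%nat.
Variable j0 : Fin.t m.
Hypothesis separated : forall gamma : multi m, exists K, forall k, (K <= k)%nat ->
  (forall j, (gamma j <= alpha k j)%nat) /\
  forall i, (i < k)%nat -> (alpha i j0 + gamma j0 < alpha k j0)%nat.
Hypothesis h_l2 : l2 h.
(** [l2_orth] only sees real parts; the arbitrary scalar [a] makes this orthogonality complex. *)
Hypothesis h_orth : forall a (sigma : multi m),
  l2_orth h (fun beta => hscal X a (f (multi_add sigma beta))).
Variable P : X -> X.
Hypothesis P_biperp : forall x, biperp X _ h (P x).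
Hypothesis P_perp : forall x, perp X _ h (hsub X x (P x)).

Let b k := P (f (alpha k)).

(* The shift by [alpha k - gamma] moves the coefficient at [alpha j] to [shifted gamma k j]. *)
Definition shifted (gamma : multi m) (k j : nat) : multi m :=
  fun c => (alpha j c + gamma c - alpha k c)%nat.

(** Under the second condition the truncated subtraction in [shifted] is exact. *)
Definition admissible (gamma : multi m) (k j : nat) : Prop :=
  (k < j)%nat /\ forall c, (alpha k c <= alpha j c + gamma c)%nat.

(** A nonzero coefficient at beta means alpha k - gamma + beta = alpha j for a unique j. The case j
    = k is beta = gamma, and j < k is excluded by the gap in coordinate [j0]. The condition on [F]
    discards the indices outside the spectrum. *)
Lemma reindex_shift gamma k (l : list (multi m)) :
  (forall j, (gamma j <= alpha k j)%nat) ->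
  (forall i, (i < k)%nat -> (alpha i j0 + gamma j0 < alpha k j0)%nat) ->
  NoDup l -> In gamma l ->
  exists J, NoDup J /\ (forall j, In j J -> admissible gamma k j) /\
    forall F : X -> X -> R, (forall x, F x (hzero X) = 0) ->
      lsum (fun beta => F (h beta) (f (multi_add (fun c => (alpha k c - gamma c)%nat) beta))) l =
      F (h gamma) (f (alpha k)) + lsum (fun j => F (h (shifted gamma k j)) (f (alpha j))) J.
Proof.
  intros Hle Hgap Hl Hin.
  set (sigma := multi_add (fun c => (alpha k c - gamma c)%nat)).
  assert (Hsg : sigma gamma = alpha k).
  { apply functional_extensionality. intros c. specialize (Hle c).
    unfold sigma, multi_add. lia. }
  (* Inverse of [alpha] on the spectrum; [l'] below keeps only those beta for which [sigma beta]
     lies there. *)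
  set (idx := fun beta => epsilon (inhabits 0%nat) (fun j => alpha j = beta)).
  assert (Hidx : forall beta, f beta <> hzero X -> alpha (idx beta) = beta).
  { intros beta Hb. unfold idx. apply epsilon_spec. now apply alpha_spec. }
  set (l' := filter (fun beta => pdec (f (sigma beta) <> hzero X)) (remove (eq_decide _) gamma l)).
  assert (Hl' : forall beta, In beta l' ->
    beta <> gamma /\ alpha (idx (sigma beta)) = sigma beta).
  { intros beta Hb. apply filter_In in Hb. destruct Hb as [Hb Hf]. rewrite pdec_true in Hf.
    apply in_remove in Hb. split; [tauto|]. apply Hidx. exact Hf. }
  assert (Hback : forall beta, In beta l' -> shifted gamma k (idx (sigma beta)) = beta).
  { intros beta Hb. destruct (Hl' beta Hb) as [_ E]. unfold shifted. rewrite E.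
    apply functional_extensionality. intros c. specialize (Hle c). unfold sigma, multi_add. lia. }
  exists (map (fun beta => idx (sigma beta)) l'). split; [|split].
  - apply NoDup_map_NoDup_ForallPairs; [|apply NoDup_filter, NoDup_remove_eq; auto].
    intros x y Hx Hy E. rewrite <- (Hback x Hx), <- (Hback y Hy), E. reflexivity.
  - intros j Hj. apply in_map_iff in Hj. destruct Hj as (beta & <- & Hb).
    destruct (Hl' beta Hb) as [Hne E]. assert (Eb := Hback beta Hb).
    set (j := idx (sigma beta)) in *. split.
    + destruct (lt_eq_lt_dec k j) as [[Hlt|Heq]|Hgt]; [exact Hlt| |].
      * exfalso. apply Hne. rewrite <- Eb, <- Heq. apply functional_extensionality.
        intros c. unfold shifted. lia.
      * exfalso. specialize (Hgap j Hgt). rewrite E in Hgap. specialize (Hle j0).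
        unfold sigma, multi_add in Hgap. lia.
    + intros c. rewrite E. specialize (Hle c). unfold sigma, multi_add. lia.
  - intros F HF. rewrite (lsum_remove _ _ gamma l Hl Hin). fold sigma. rewrite Hsg. f_equal.
    rewrite lsum_map. rewrite <- (lsum_filter _ _ (fun beta => pdec (f (sigma beta) <> hzero X))).
    + apply lsum_ext. intros beta Hb. rewrite (Hback beta Hb). destruct (Hl' beta Hb) as [_ ->].
      reflexivity.
    + intros beta _ Hb. destruct (classic (f (sigma beta) = hzero X)) as [->|Hn]; [apply HF|].
      apply (proj2 (pdec_true _)) in Hn. congruence.
Qed.

(** x - P x is orthogonal to every [h beta], so coefficients of [f] may be replaced by their
    projections. *)
Lemma rip_h_P a beta x : rip (h beta) (hscal X a (P x)) = rip (h beta) (hscal X a x).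
Proof.
  destruct (P_perp x beta) as [E1 E2]. rewrite rip_sym in E1. rewrite iip_sym in E2.
  revert E1 E2. ipexpand. intros. replace (rip (h beta) (P x)) with (rip (h beta) x) by lra.
  replace (iip (h beta) (P x)) with (iip (h beta) x) by lra. reflexivity.
Qed.

(* Pairing [h] with the shift of [f] by [alpha k - gamma] isolates the term at [gamma]; the
   remaining terms only involve coefficients beyond the k-th and are bounded by Cauchy-Schwarz. *)
Lemma coefficient_bound gamma k a R e :
  Cre a * Cre a + Cim a * Cim a = 1 ->
  (forall j, (gamma j <= alpha k j)%nat) ->
  (forall i, (i < k)%nat -> (alpha i j0 + gamma j0 < alpha k j0)%nat) ->
  (forall J, NoDup J -> (forall j, In j J -> (k < j)%nat) -> lsum (fun j => nsq (b j)) J <= R) ->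
  (forall J, NoDup J -> (forall j, In j J -> admissible gamma k j) ->
     lsum (fun j => nsq (h (shifted gamma k j))) J <= e) ->
  rip (h gamma) (hscal X a (b k)) * rip (h gamma) (hscal X a (b k)) <= R * e.
Proof.
  intros Ha Hle Hgap HR He.
  (* It suffices that t^2 R + 2 t x + e is nonnegative for all t, up to any [eps], where x is the
     pairing at gamma. *)
  apply discriminant_nonpos.
  { apply (HR nil); [constructor | intros j []]. }
  intros t. apply le_epsilon. intros eps Heps.
  set (x := rip (h gamma) (hscal X a (b k))).
  (* [d] is the error allowed in the orthogonality relation; multiplied by 2|t| it stays below
     [eps]. *)
  set (d := eps / (2 * Rabs t + 1)). assert (Ht := Rabs_pos t).
  assert (Hd : 0 < d) by (apply Rdiv_lt_0_compat; lra).
  assert (Ed : d * (2 * Rabs t + 1) = eps) by (unfold d; field; lra).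
  destruct (h_orth a (fun c => (alpha k c - gamma c)%nat) d Hd) as [l0 Hl0].
  set (l := lunion (gamma :: nil) l0).
  destruct (lunion_spec _ (gamma :: nil) l0) as (Hl & Hl1 & Hl2). fold l in Hl, Hl1, Hl2.
  specialize (Hl0 l Hl Hl2).
  destruct (reindex_shift gamma k l Hle Hgap Hl (Hl1 gamma (or_introl eq_refl)))
    as (J & HJ & Hadm & Hsum).
  rewrite (Hsum (fun u v => rip u (hscal X a v))) in Hl0 by (intros; ipexpand; ring).
  rewrite <- rip_h_P in Hl0. fold (b k) in Hl0. fold x in Hl0.
  set (S := lsum (fun j => rip (h (shifted gamma k j)) (hscal X a (f (alpha j)))) J) in Hl0.
  assert (HR' := HR J HJ (fun j Hj => proj1 (Hadm j Hj))). assert (He' := He J HJ Hadm).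
  (* Each term uses |t a v - u|^2 >= 0 with |a| = 1. *)
  assert (Hq : lsum (fun j => 2 * t * rip (h (shifted gamma k j)) (hscal X a (f (alpha j)))) J <=
    lsum (fun j => t * t * nsq (b j) + nsq (h (shifted gamma k j))) J).
  { apply lsum_le. intros j _. rewrite <- rip_h_P. fold (b j).
    set (u := h (shifted gamma k j)). set (v := b j).
    assert (H := nsq_nonneg X (hsub X (hscal X (RtoC t) (hscal X a v)) u)).
    revert H. ipexpand. rewrite (rip_sym X v u), (iip_sym X v u), iip_diag.
    intros H. assert (E : t * t * (Cre a * Cre a + Cim a * Cim a) * rip v v = t * t * rip v v)
      by (rewrite Ha; ring).
    lra. }
  rewrite lsum_add, !lsum_scal in Hq. fold S in Hq.
  assert (Hs : - (2 * t * (x + S)) <= 2 * Rabs t * d).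
  { assert (Habs := Rle_abs (- (2 * t * (x + S)))).
    rewrite Rabs_Ropp, !Rabs_mult, (Rabs_right 2) in Habs by lra.
    assert (0 <= Rabs (x + S)) by apply Rabs_pos. nra. }
  assert (Htt : 0 <= t * t) by nra. nra.
Qed.

(** Summation over the second component j gives the weight e_gamma(k). *)
Definition pair_energy (gamma : multi m) (p : nat * nat) : R :=
  if pdec (admissible gamma (fst p) (snd p)) then nsq (h (shifted gamma (fst p) (snd p))) else 0.

Lemma pair_energy_nonneg gamma p : 0 <= pair_energy gamma p.
Proof. unfold pair_energy. destruct (pdec _); [apply nsq_nonneg | lra]. Qed.

Lemma pair_energy_admissible gamma k j : admissible gamma k j ->
  pair_energy gamma (k, j) = nsq (h (shifted gamma k j)).
Proof. intros H. unfold pair_energy. cbn [fst snd]. now rewrite (proj2 (pdec_true _) H). Qed.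

(** Admissible pairs (k, j) with the same shifted index beta share the difference alpha j - alpha k
    = beta - gamma, and at most [C] pairs do so. Hence the sum is at most C |h|^2. *)
Lemma pair_energy_summable gamma : summable (pair_energy gamma).
Proof.
  exists (INR C * total (fun beta => nsq (h beta))). intros L HL.
  set (adm := fun p : nat * nat => pdec (admissible gamma (fst p) (snd p))).
  rewrite <- (lsum_filter _ _ adm).
  2: { intros p _ Hp. unfold pair_energy. unfold adm in Hp. now rewrite Hp. }
  rewrite (lsum_ext _ _ (fun p => nsq (h (shifted gamma (fst p) (snd p))))).
  2: { intros p Hp. apply filter_In in Hp. destruct Hp as [_ Hp]. unfold pair_energy, adm in *.
       now rewrite Hp. }
  apply (lsum_fiber_le _ _ (fun p => shifted gamma (fst p) (snd p)) (fun beta => nsq (h beta)));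
    [intros; apply nsq_nonneg | exact h_l2 |].
  intros beta. set (L' := filter _ (filter adm L)).
  assert (HL' : forall p, In p L' ->
    admissible gamma (fst p) (snd p) /\ shifted gamma (fst p) (snd p) = beta).
  { intros p Hp. apply filter_In in Hp. destruct Hp as [Hp E]. apply filter_In in Hp.
    split; apply pdec_true; tauto. }
  rewrite <- (length_map (fun p => (alpha (snd p), alpha (fst p)))).
  apply (few_differences (fun c => (Z.of_nat (beta c) - Z.of_nat (gamma c))%Z)).
  - apply NoDup_map_NoDup_ForallPairs; [|apply NoDup_filter, NoDup_filter; auto].
    intros [k j] [k' j'] _ _ E. injection E as E1 E2. apply alpha_inj in E1, E2.
    cbn in *. congruence.
  - intros p Hp. apply in_map_iff in Hp. destruct Hp as ([k j] & <- & Hp).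
    destruct (HL' _ Hp) as [[Hkj Hadm] E]. cbn [fst snd] in *.
    split; [apply alpha_spec; now exists j|]. split; [apply alpha_spec; now exists k|].
    split; [intros Ea; apply alpha_inj in Ea; lia|].
    intros c. specialize (Hadm c). rewrite <- E. unfold shifted. lia.
Qed.

Lemma pair_energy_section_summable gamma k : summable (fun j => pair_energy gamma (k, j)).
Proof.
  exists (total (pair_energy gamma)). intros J HJ.
  rewrite <- (lsum_map _ _ (fun j => (k, j))).
  apply total_ge; [apply pair_energy_summable|].
  apply NoDup_map_NoDup_ForallPairs; auto. intros j j' _ _ E. congruence.
Qed.

(** The squared modulus of <h gamma, b k>. *)
Definition pairing_sq (gamma : multi m) (k : nat) : R :=
  rip (h gamma) (b k) * rip (h gamma) (b k) + iip (h gamma) (b k) * iip (h gamma) (b k).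

Definition tail_bound (K : nat) (R : R) : Prop :=
  forall J, NoDup J -> (forall j, In j J -> (K <= j)%nat) -> lsum (fun j => nsq (b j)) J <= R.

(** Each term is at most 2 R e(k), where e(k) sums [pair_energy] over j, and the tail of e is at
    most eps/2. *)
Lemma pairing_sq_tail_small gamma eps : 0 < eps -> exists K0, forall K R l,
  (K0 <= K)%nat -> tail_bound K R -> NoDup l -> (forall k, In k l -> (K <= k)%nat) ->
  lsum (pairing_sq gamma) l <= eps * R.
Proof.
  intros He. destruct (separated gamma) as [K1 HK1].
  destruct (summable_tail_small _ _ (eps / 2) (pair_energy_nonneg gamma)
    (pair_energy_summable gamma)) as [L0 HL0]; [lra|].
  (* [K2] bounds the first components occurring in [L0], so pairs with k > K2 avoid that list. *)
  destruct (prefix_bounded (fun i => fst (nth i L0 (0, 0)%nat)) (length L0)) as [K2 HK2].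
  exists (K1 + K2 + 1)%nat. intros K R l HK HR Hl Hlk.
  assert (HR0 : 0 <= R) by (apply (HR nil); [constructor | intros j []]).
  set (e := fun k => total (fun j => pair_energy gamma (k, j))).
  assert (Hsum : lsum e l <= eps / 2).
  { apply lsum_total_le; auto; [intros; apply pair_energy_section_summable|].
    intros L HL Hfst. apply HL0; auto. intros p Hp Hp0.
    apply (In_nth _ _ (0, 0)%nat) in Hp0. destruct Hp0 as (i & Hi & E).
    specialize (HK2 i ltac:(lia)). cbn beta in HK2. rewrite E in HK2.
    specialize (Hlk _ (Hfst p Hp)). lia. }
  apply Rle_trans with (lsum (fun k => 2 * R * e k) l).
  - apply lsum_le. intros k Hk. specialize (Hlk k Hk).
    destruct (HK1 k ltac:(lia)) as [Hle Hgap].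
    assert (Hb : forall a, Cre a * Cre a + Cim a * Cim a = 1 ->
      rip (h gamma) (hscal X a (b k)) * rip (h gamma) (hscal X a (b k)) <= R * e k).
    { intros a Ha. apply coefficient_bound; auto.
      - intros J HJ HkJ. apply HR; auto. intros j Hj. specialize (HkJ j Hj). lia.
      - intros J HJ Hadm. rewrite (lsum_ext _ _ (fun j => pair_energy gamma (k, j))).
        + apply total_ge; auto. apply pair_energy_section_summable.
        + intros j Hj. symmetry. apply pair_energy_admissible; auto. }
    (* a = 1 bounds the real part of the pairing, a = i the imaginary part. *)
    assert (B1 := Hb Defs.C1). assert (B2 := Hb Ci). revert B1 B2. ipexpand.
    intros B1 B2. specialize (B1 ltac:(ring)). specialize (B2 ltac:(ring)).
    unfold pairing_sq. nra.
  - rewrite lsum_scal. nra.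
Qed.

Lemma pairing_sq_list_tail_small (F : list (multi m)) eps : 0 < eps -> exists K0, forall K R l,
  (K0 <= K)%nat -> tail_bound K R -> NoDup l -> (forall k, In k l -> (K <= k)%nat) ->
  lsum (fun k => lsum (fun gamma => pairing_sq gamma k) F) l <= eps * R.
Proof.
  revert eps. induction F as [|gamma F IH]; intros eps He.
  - exists 0%nat. intros K R l _ HR _ _.
    assert (HR0 : 0 <= R) by (apply (HR nil); [constructor | intros j []]).
    rewrite lsum_exchange. simpl. nra.
  - destruct (IH (eps / 2)) as [K1 H1]; [lra|].
    destruct (pairing_sq_tail_small gamma (eps / 2)) as [K2 H2]; [lra|].
    exists (K1 + K2)%nat. intros K R l HK HR Hl Hlk.
    specialize (H1 K R l ltac:(lia) HR Hl Hlk). specialize (H2 K R l ltac:(lia) HR Hl Hlk).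
    assert (E : lsum (fun k => lsum (fun g => pairing_sq g k) (gamma :: F)) l =
      lsum (pairing_sq gamma) l + lsum (fun k => lsum (fun g => pairing_sq g k) F) l).
    { rewrite <- lsum_add. reflexivity. }
    rewrite E. lra.
Qed.

(** * Compactness and vanishing of the late projected coefficients *)

Hypothesis b_compact : rel_compact X (fun y => exists k, b k <> hzero X /\
  y = hscal X (RtoC (/ hnorm X (b k))) (b k)).

Lemma pairing_sq_nonneg gamma k : 0 <= pairing_sq gamma k.
Proof. unfold pairing_sq. nra. Qed.

(* Otherwise a limit of normalized [b k] would be a unit vector of the closed span of the
   [h gamma] orthogonal to all of them. *)
Lemma finitely_many_pairings_suffice : exists (F : list (multi m)) (c : R), 0 < c /\
  forall k, c * nsq (b k) <= lsum (fun gamma => pairing_sq gamma k) F.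
Proof.
  apply NNPP. intros Hno.
  (* The negation is applied to the first n enumerated multi-indices with constant 1/(n+1). *)
  assert (Hbad : forall n, exists k,
    lsum (fun gamma => pairing_sq gamma k) (map (multi_enum m) (seq 0 n))
      < / (INR n + 1) * nsq (b k)).
  { intros n. apply NNPP. intros Hn. apply Hno.
    exists (map (multi_enum m) (seq 0 n)), (/ (INR n + 1)). split; [apply inv_succ_pos|].
    intros k. apply Rnot_lt_le. intros H. apply Hn. now exists k. }
  set (kk := fun n => proj1_sig (constructive_indefinite_description _ (Hbad n))).
  assert (Hkk : forall n, lsum (fun gamma => pairing_sq gamma (kk n))
    (map (multi_enum m) (seq 0 n)) < / (INR n + 1) * nsq (b (kk n))).
  { intros n. exact (proj2_sig (constructive_indefinite_description _ (Hbad n))). }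
  clearbody kk.
  assert (Hpos : forall n, 0 < nsq (b (kk n))).
  { intros n. specialize (Hkk n). assert (Hi := inv_succ_pos n).
    assert (H := lsum_nonneg _ (fun gamma => pairing_sq gamma (kk n))
      (map (multi_enum m) (seq 0 n)) (fun gamma => pairing_sq_nonneg gamma _)).
    assert (Hq := nsq_nonneg X (b (kk n))). nra. }
  set (u := fun n => hscal X (RtoC (/ hnorm X (b (kk n)))) (b (kk n))).
  assert (Hinv : forall n, / hnorm X (b (kk n)) * / hnorm X (b (kk n)) * nsq (b (kk n)) = 1).
  { intros n. specialize (Hpos n). rewrite <- hnorm_sq in *. field. nra. }
  destruct (b_compact u) as (ph & y & Hph & Hy).
  { intros n. exists (kk n). split; [|reflexivity]. intros E. specialize (Hpos n).
    rewrite E in Hpos. revert Hpos. ipexpand. lra. }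
  assert (Hunit : nsq y = 1).
  { apply (converges_unit X _ y Hy). intros n. rewrite <- (Hinv (ph n)). unfold u.
    ipexpand. rewrite iip_diag. ring. }
  assert (Hge : forall n, (n <= ph n)%nat).
  { induction n as [|n IH]; [lia|]. specialize (Hph n). lia. }
  assert (Hsmall : forall i n, (i < n)%nat ->
    rip (u n) (h (multi_enum m i)) * rip (u n) (h (multi_enum m i)) +
    iip (u n) (h (multi_enum m i)) * iip (u n) (h (multi_enum m i)) <= / (INR n + 1)).
  { intros i n Hi. set (gamma := multi_enum m i). specialize (Hkk n). specialize (Hinv n).
    assert (Hone : pairing_sq gamma (kk n) <=
      lsum (fun gamma => pairing_sq gamma (kk n)) (map (multi_enum m) (seq 0 n))).
    { rewrite lsum_map.
      assert (H := lsum_incl _ (fun i => pairing_sq (multi_enum m i) (kk n)) (i :: nil) (seq 0 n)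
        (fun i => pairing_sq_nonneg _ _) ltac:(constructor; [intros []|constructor])
        (seq_NoDup n 0)).
      simpl in H. rewrite Rplus_0_r in H. apply H.
      intros x [<-|[]]. apply in_seq. lia. }
    unfold u. ipexpand. rewrite (rip_sym X (b (kk n))), (iip_sym X (b (kk n))).
    set (r := / hnorm X (b (kk n))) in *. unfold pairing_sq at 1 in Hone.
    set (A := rip (h gamma) (b (kk n))) in *. set (B := iip (h gamma) (b (kk n))) in *.
    assert (Hp := inv_succ_pos n).
    replace ((r * A - 0 * - B) * (r * A - 0 * - B) + (r * - B + 0 * A) * (r * - B + 0 * A))
      with (r * r * (A * A + B * B)) by ring.
    apply Rle_trans with (r * r * (/ (INR n + 1) * nsq (b (kk n)))); [|right].
    - apply Rmult_le_compat_l; [apply Rle_0_sqr | lra].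
    - replace (r * r * (/ (INR n + 1) * nsq (b (kk n)))) with
        (r * r * nsq (b (kk n)) * / (INR n + 1)) by ring.
      rewrite Hinv. ring. }
  (* A limit along [ph] of quantities with square at most 1/(n+1) is 0, because ph n >= n. *)
  assert (Hzero : forall (v : nat -> R) (z : R) i, Un_cv (fun n => v (ph n)) z ->
    (forall n, (i < n)%nat -> v n * v n <= / (INR n + 1)) -> z = 0).
  { intros v z i Hv Hvs. apply cond_eq. intros eps He. rewrite Rminus_0_r.
    destruct (Hv (eps / 2)) as [N HN]; [lra|].
    destruct (inv_succ_small (eps / 2 * (eps / 2))) as [N' HN']; [nra|].
    set (n := (N + N' + i + 1)%nat). specialize (HN n ltac:(unfold n; lia)).
    assert (Hn := Hge n). specialize (Hvs (ph n) ltac:(unfold n in *; lia)).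
    assert (Ha := inv_succ_anti N' (ph n) ltac:(unfold n in *; lia)).
    unfold R_dist in HN. apply Rabs_def2 in HN.
    assert (v (ph n) < eps / 2) by nra. assert (- (eps / 2) < v (ph n)) by nra.
    apply Rabs_def1; lra. }
  assert (Hperp : perp X _ h y).
  { intros gamma. destruct (multi_enum_surj m gamma) as [i <-]. split.
    - apply (Hzero (fun n => rip (u n) (h (multi_enum m i))) _ i).
      + apply (converges_rip X (fun n => u (ph n))). exact Hy.
      + intros n Hn. specialize (Hsmall i n Hn). nra.
    - apply (Hzero (fun n => iip (u n) (h (multi_enum m i))) _ i).
      + apply (converges_iip X (fun n => u (ph n))). exact Hy.
      + intros n Hn. specialize (Hsmall i n Hn). nra. }
  assert (Hbi : biperp X _ h y).
  { apply (biperp_converges X _ h (fun n => u (ph n)) y Hy). intros n.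
    apply biperp_scal, P_biperp. }
  rewrite (biperp_perp_zero X _ h y Hbi Hperp) in Hunit. revert Hunit. ipexpand. lra.
Qed.

Lemma nsq_P_le x : nsq (P x) <= nsq x.
Proof.
  assert (H := P_biperp x _ (P_perp x)).
  assert (Hq := nsq_nonneg X (hsub X x (P x))). revert H Hq. ipexpand.
  rewrite (rip_sym X x (P x)). intros. lra.
Qed.

Lemma projected_coefficients_summable : summable (fun k => nsq (b k)).
Proof.
  destruct f_l2 as [M HM]. exists M. intros l Hl.
  apply Rle_trans with (lsum (fun k => nsq (f (alpha k))) l).
  - apply lsum_le. intros k _. apply nsq_P_le.
  - rewrite <- (lsum_map _ _ alpha (fun beta => nsq (f beta))). apply HM.
    apply NoDup_map_NoDup_ForallPairs; auto. intros k k' _ _. apply alpha_inj.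
Qed.

(** Let T be the sum of |b k|^2 over k >= K. Compactness bounds c T by the sum of the pairings,
    which is at most (c/2) T for large K. As T is finite, T = 0. *)
Lemma projected_coefficients_vanish : exists K, forall k, (K <= k)%nat -> b k = hzero X.
Proof.
  destruct finitely_many_pairings_suffice as (F & c & Hc & HF).
  destruct (pairing_sq_list_tail_small F (c / 2)) as [K HK]; [lra|].
  (* Truncation at [K], so that [total g] is the tail sum and can itself serve as the
     [tail_bound]. *)
  exists K. set (g := fun k => if pdec (K <= k)%nat then nsq (b k) else 0).
  assert (Hfil : forall l,
    lsum g l = lsum (fun k => nsq (b k)) (filter (fun k => pdec (K <= k)%nat) l)).
  { intros l. rewrite <- (lsum_filter _ g (fun k => pdec (K <= k)%nat)).
    - apply lsum_ext. intros k Hk. apply filter_In in Hk. unfold g. now destruct Hk as [_ ->].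
    - intros k _ E. unfold g. now rewrite E. }
  assert (Hg : summable g).
  { destruct projected_coefficients_summable as [M HM]. exists M. intros l Hl. rewrite Hfil.
    apply HM, NoDup_filter; auto. }
  assert (HR : tail_bound K (total g)).
  { intros J HJ HKJ. rewrite (lsum_ext _ _ g).
    - apply total_ge; auto.
    - intros k Hk. unfold g. rewrite (proj2 (pdec_true _)); auto. }
  assert (Hhalf : total g <= total g / 2).
  { apply total_least; auto. intros l Hl. rewrite Hfil.
    set (l' := filter (fun k => pdec (K <= k)%nat) l).
    assert (H := HK K (total g) l' (Nat.le_refl K) HR (NoDup_filter _ Hl)
      ltac:(intros k Hk; apply filter_In in Hk; apply pdec_true; tauto)).
    assert (H' : lsum (fun k => c * nsq (b k)) l' <=
      lsum (fun k => lsum (fun gamma => pairing_sq gamma k) F) l') by (apply lsum_le; auto).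
    rewrite lsum_scal in H'. nra. }
  intros k Hk. apply nsq_zero_inv.
  assert (H := HR (k :: nil) ltac:(constructor; [intros []|constructor])
    ltac:(intros j [<-|[]]; exact Hk)).
  simpl in H. assert (Hq := nsq_nonneg X (b k)). lra.
Qed.

Hypothesis tails_span : forall k : nat,
  closed_span_is_X X (fun i : nat => (k <= i)%nat) (fun i => f (alpha i)).

(** Combinations z of late coefficients approximate h gamma, yet are orthogonal to it since their
    projections vanish. Thus |h gamma|^2 <= |h gamma - z|^2 <= eps. *)
Theorem residual_zero gamma : h gamma = hzero X.
Proof.
  destruct projected_coefficients_vanish as [K HK].
  apply nsq_zero_inv, Rle_antisym; [|apply nsq_nonneg].
  apply le_epsilon. intros eps He. rewrite Rplus_0_l.
  assert (Hs : 0 < sqrt eps) by now apply sqrt_lt_R0.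
  destruct (tails_span K (h gamma) (sqrt eps) Hs) as (L & HL & Hd).
  apply hnorm_le_nsq in Hd; auto. rewrite sqrt_sqrt in Hd by lra.
  set (z := lincomb X (fun i => f (alpha i)) L) in Hd.
  assert (Hz : rip z (h gamma) = 0).
  { apply lincomb_orth. intros p Hp. destruct (P_perp (f (alpha (snd p))) gamma) as [E1 E2].
    fold (b (snd p)) in E1, E2. rewrite (HK _ (HL p Hp)) in E1, E2. revert E1 E2. ipexpand.
    intros. split; lra. }
  revert Hd. assert (Hq := nsq_nonneg X z). revert Hq. ipexpand.
  rewrite (rip_sym X (h gamma) z), Hz. intros. lra.
Qed.

End Residual.

(** * Necessity of the span condition; square summability of the shift span *)

Section Cyclicity.
Variables (X : Hilbert) (m : nat) (f : multi m -> X) (alpha : nat -> multi m).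
Hypothesis alpha_spec : forall beta, in_spectrum X m f beta <-> exists k, alpha k = beta.

(* Testing cyclicity on [x z^gamma] with [gamma] beyond the first k multi-indices. *)
Lemma cyclic_tails_span : (1 <= m)%nat -> cyclic X m f -> forall k : nat,
  closed_span_is_X X (fun i : nat => (k <= i)%nat) (fun i => f (alpha i)).
Proof.
  intros Hm Hc k x eps He.
  destruct m as [|m']; [lia|].
  destruct (prefix_bounded (fun i => alpha i Fin.F1) k) as [M HM].
  (* Its first coordinate exceeds that of alpha i for i <= k, so s + gamma = alpha j forces j >
     k. *)
  set (gamma := (fun _ => S M) : multi (S m')).
  set (g := fun beta : multi (S m') => if pdec (beta = gamma) then x else hzero X).
  assert (Hg : in_H2 X (S m') g).
  { apply in_H2_l2. exists (nsq x). intros l Hl.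
    apply Rle_trans with (lsum (fun beta => nsq (g beta)) (gamma :: nil)).
    - rewrite <- (lsum_filter _ _ (fun beta => pdec (beta = gamma))).
      + apply lsum_incl; [intros; apply nsq_nonneg | now apply NoDup_filter | |].
        * constructor; [intros []|constructor].
        * intros beta Hb. apply filter_In in Hb. destruct Hb as [_ Hb]. rewrite pdec_true in Hb.
          now left.
      + intros beta _ E. unfold g. rewrite E. ipexpand. reflexivity.
    - simpl. unfold g. rewrite (proj2 (pdec_true _) eq_refl). lra. }
  destruct (Hc g Hg eps He) as [L HL].
  specialize (HL (gamma :: nil) ltac:(constructor; [intros []|constructor])).
  cbn [fold_right] in HL. unfold g in HL. rewrite (proj2 (pdec_true _) eq_refl) in HL.
  unfold H2_lincomb, bshift in HL.
  assert (Hconv : exists L', (forall p, In p L' -> (k <= snd p)%nat) /\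
    lincomb X (fun i => f (alpha i)) L' = lincomb X (fun a => f (multi_add a gamma)) L).
  { clear HL. induction L as [|[a s] L (L' & H1 & H2)].
    - exists nil. split; [intros p []|reflexivity].
    - destruct (classic (f (multi_add s gamma) = hzero X)) as [E|Hn].
      + exists L'. split; auto. rewrite H2. unfold lincomb. simpl. rewrite E.
        apply hext. intros z. ipexpand. ring.
      + destruct (proj1 (alpha_spec _) Hn) as [j Hj]. exists ((a, j) :: L'). split.
        * intros p [<-|Hp]; auto. cbn [snd]. apply Nat.nlt_ge. intros Hlt.
          specialize (HM j ltac:(lia)). cbn beta in HM. rewrite Hj in HM.
          unfold multi_add, gamma in HM. lia.
        * unfold lincomb in *. simpl. rewrite H2, Hj. reflexivity. }
  destruct Hconv as (L' & HL1 & HL2). exists L'. split; auto.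
  rewrite HL2. rewrite hnorm_sq in HL. apply hnorm_le_nsq; auto. simpl in HL. lra.
Qed.

(** Adding a multi-index is injective, so a shift does not increase the norm; sums are handled by |x
    + y|^2 <= 2|x|^2 + 2|y|^2. *)
Lemma shift_span_l2 : l2 f -> forall L, l2 (H2_lincomb X m L f).
Proof.
  intros Hf L. induction L as [|[a s] L IH].
  - exists 0. intros l _. right. rewrite (lsum_ext _ _ (fun _ => 0 * 0)).
    + rewrite lsum_scal. ring.
    + intros beta _. unfold H2_lincomb, lincomb. simpl. ipexpand. ring.
  - set (A := Cre a * Cre a + Cim a * Cim a). assert (HA : 0 <= A) by (unfold A; nra).
    destruct Hf as [M HM], IH as [M' HM']. exists (2 * (A * M) + 2 * M'). intros l Hl.
    apply Rle_trans with (lsum (fun beta => 2 * (A * nsq (f (multi_add s beta))) +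
      2 * nsq (H2_lincomb X m L f beta)) l).
    + apply lsum_le. intros beta _. unfold H2_lincomb at 1, lincomb. cbn [fold_right fst snd].
      eapply Rle_trans; [apply nsq_add_le|]. right. unfold bshift, A. f_equal. f_equal.
      ipexpand. rewrite iip_diag. ring.
    + rewrite lsum_add, !lsum_scal. specialize (HM' l Hl).
      assert (H := HM (map (multi_add s) l)). rewrite lsum_map in H.
      assert (Hn : NoDup (map (multi_add s) l)).
      { apply NoDup_map_NoDup_ForallPairs; auto. intros b b' _ _ E.
        apply functional_extensionality. intros j. apply (f_equal (fun q => q j)) in E.
        unfold multi_add in E. lia. }
      specialize (H Hn). nra.
Qed.

End Cyclicity.

(** * The cyclicity criterion: both directions combined *)

Theorem mainTheorem19 (X : Hilbert) (m : nat) (f : multi m -> X)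
  (alpha : nat -> multi m) :
  separable X ->
  (1 <= m)%nat ->
  in_H2 X m f ->
  (* alpha enumerates sigma(f) by distinct multi-indices *)
  (forall k k', alpha k = alpha k' -> k = k') ->
  (forall beta, in_spectrum X m f beta <-> exists k, alpha k = beta) ->
  (* (C1) *)
  (exists C : nat, forall beta : Fin.t m -> Z,
     forall l : list (multi m * multi m), NoDup l ->
       (forall p, In p l ->
          in_spectrum X m f (fst p) /\ in_spectrum X m f (snd p) /\ fst p <> snd p /\
          (forall j, (Z.of_nat (fst p j) - Z.of_nat (snd p j))%Z = beta j)) ->
       (length l <= C)%nat) ->
  (* (C2) *)
  (forall j : Fin.t m, forall M : Z, exists K, forall k, (K <= k)%nat ->
       (M <= Z.of_nat (alpha (S k) j) - Z.of_nat (alpha k j))%Z) ->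
  completely_rel_compact X (fun k => f (alpha k)) ->
  (cyclic X m f <->
   forall k : nat, closed_span_is_X X (fun i : nat => (k <= i)%nat) (fun i => f (alpha i))).
Proof.
  intros _ Hm Hf Hinj Hspec [C HC1] HC2 Hcpt.
  split; [now apply cyclic_tails_span|]. intros Hspan g Hg eps He.
  apply in_H2_l2 in Hf, Hg.
  (* [h] is the component of [g] orthogonal to all backward shifts of [f]; approximability of [g]
     follows once h = 0. *)
  destruct (l2_projection X (multi m) (fun phi => exists L, phi = H2_lincomb X m L f))
    with (g := g) as (h & Hh & Happ & Horth); auto.
  { intros phi [L ->]. now apply shift_span_l2. }
  { exists nil. reflexivity. }
  { intros phi psi [L ->] [L' ->]. exists (L ++ L'). apply functional_extensionality.
    intros beta. unfold H2_lincomb. now rewrite lincomb_app. }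
  { intros r phi [L ->]. exists (map (fun p => (Cmul (RtoC r) (fst p), snd p)) L).
    apply functional_extensionality. intros beta. unfold H2_lincomb. now rewrite lincomb_scal. }
  assert (j0 : Fin.t m) by (destruct m; [lia | exact Fin.F1]).
  assert (Hsep : forall gamma : multi m, exists K, forall k, (K <= k)%nat ->
    (forall j, (gamma j <= alpha k j)%nat) /\
    forall i, (i < k)%nat -> (alpha i j0 + gamma j0 < alpha k j0)%nat).
  { intros gamma.
    destruct (eventually_all_coordinates m (fun j k => (gamma j <= alpha k j)%nat /\
      forall i, (i < k)%nat -> (alpha i j + gamma j < alpha k j)%nat)) as [K HK].
    - intros j. apply (gaps_separate (fun k => alpha k j) (HC2 j)).
    - exists K. intros k Hk. split; [intros j|]; apply HK; auto. }
  destruct (family_projection X (multi m) h) as (P & HP & HPb & HPp).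
  assert (Hzero : forall gamma, h gamma = hzero X).
  { apply (residual_zero X m f alpha h Hf Hinj Hspec C HC1 j0 Hsep Hh) with (P := P); auto.
    intros a sigma. replace (fun beta => hscal X a (f (multi_add sigma beta))) with
      (H2_lincomb X m ((a, sigma) :: nil) f); [apply Horth; eauto|].
    apply functional_extensionality. intros beta.
    exact (lincomb_single X _ (fun s => bshift X m s f beta) a sigma). }
  (* With h = 0, approximating g - h is approximating [g] itself; eps^2 matches the squared
     distance. *)
  destruct (Happ (eps ^ 2)) as (phi & (L & ->) & HL); [simpl; nra|].
  exists L. intros l Hl. specialize (HL l Hl).
  eapply Rle_trans; [right|exact HL]. apply lsum_ext. intros beta _.
  rewrite hnorm_sq, Hzero. f_equal. apply hext. intros z. ipexpand. ring.
Qed.
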